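(* Let $1<p<\infty$ and let $R=\{R_s\}_{s=1}^N$ be a lower bound collection of linear operators. Then for any $m\in\mathbb{N}$, any $m\times m$ matrix $\mathrm{A}_p$ weights $U,V$ on $\mathbb{R}^d$ and any $m\times m$ locally integrable matrix symbol $B$, $$\|B\|_{\widetilde{\mathrm{BMO}}^p_{V,U}}\le C\max_{1\le s\le N}\|[M_B,R_s\otimes\mathbf{I}_m]\|_{L^p(U)\to L^p(V)},$$ where $C$ depends possibly on $m,p,d$ and $R$ but is independent of $U$, $V$ and $B$.
   Context: $\frac1p+\frac1{p'}=1$. $\fint_Q$ denotes the unweighted average over $Q$. $\|\cdot\|$ on matrices is the operator norm. An $n\times n$ matrix weight is a measurable $n\times n$ matrix valued function $W$ on $\mathbb{R}^d$ that is positive definite a.e. $L^p(W)$ is the space of $\mathbb{C}^n$ valued functions $\vec f$ with $\|\vec f\|_{L^p(W)}=\left(\int_{\mathbb{R}^d}|W^{1/p}(x)\vec f(x)|^p\,dx\right)^{1/p}<\infty$. $W$ is a matrix $\mathrm{A}_p$ weight if $$[W]_{\mathrm{A}_p}=\sup_{Q\text{ cube}}\fint_Q\left(\fint_Q\|W^{1/p}(x)W^{-1/p}(y)\|^{p'}\,dy\right)^{p/p'}dx<\infty.$$ $T\otimes\mathbf{I}_n$ acts on $\mathbb{C}^n$ valued functions by applying $T$ to each component; $M_B$ is pointwise multiplication by $B$; $[M_B,S]=M_BS-SM_B$. $\|\cdot\|_{L^p(U)\to L^p(V)}$ is the operator norm ($+\infty$ if the operator is not bounded). Lower bound collection: a finite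 collection $R=\{R_s\}_{s=1}^N$ of linear operators defined on scalar valued functions on $\mathbb{R}^d$ such that for every $n\in\mathbb{N}$ (i) there is a constant $C_n$ (possibly depending on $n$) with $[W]_{\mathrm{A}_p}^{1/p}\le C_n\max_{1\le s\le N}\|R_s\otimes\mathbf{I}_n\|_{L^p(W)\to L^p(W)}$ for every $n\times n$ matrix weight $W$, and (ii) each $R_s\otimes\mathbf{I}_n$ is bounded on $L^p(W)$ whenever $W$ is an $n\times n$ matrix $\mathrm{A}_p$ weight. Finally $$\|B\|_{\widetilde{\mathrm{BMO}}^p_{V,U}}^p=\sup_{Q\text{ cube}}\fint_Q\left(\fint_Q\|V^{1/p}(x)(B(x)-B(y))U^{-1/p}(y)\|^{p'}\,dy\right)^{p/p'}dx.$$ *)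

(* Defs.v *)
From HB Require Import structures.
From mathcomp Require Import all_boot all_order all_algebra.
From mathcomp Require Import complex.
From mathcomp Require Import all_classical all_reals all_analysis.
Set Implicit Arguments.
Unset Strict Implicit.
Unset Printing Implicit Defensive.
Import Order.TTheory GRing.Theory Num.Theory.
Import numFieldNormedType.Exports.
Local Open Scope classical_set_scope.
Local Open Scope ring_scope.

(* The library has no Lebesgue measure on R^d.  It is built here as the
   restriction of the Lebesgue outer measure (infimum of the total volume of
   countable covers by boxes) to its Caratheodory sigma-algebra, so that
   "measurable" below is Lebesgue measurability on R^d = 'rV[R]_d. *)
Section lebesgue_outer_measure.
Context {R : realType} {d : nat}.
Local Open Scope ereal_scope.

(* [None] is the empty box: when d = 0 no pair (a, b) denotes it. *)
Definition box (I : option ('rV[R]_d * 'rV[R]_d)) : set 'rV[R]_d :=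
  if I is Some (a, b)
  then [set x | forall i, (a ord0 i <= x ord0 i <= b ord0 i)%R]
  else set0.

Definition box_volume (I : option ('rV[R]_d * 'rV[R]_d)) : \bar R :=
  if I is Some (a, b)
  then (\prod_(i < d) Num.max 0 (b ord0 i - a ord0 i))%R%:E
  else 0.

Definition box_cover (X : set 'rV[R]_d) :=
  [set I : nat -> option ('rV[R]_d * 'rV[R]_d) | X `<=` \bigcup_k box (I k)].

Definition lebesgue_outer (X : set 'rV[R]_d) : \bar R :=
  ereal_inf [set \sum_(k <oo) box_volume (I k) | I in box_cover X].

Lemma box_volume_ge0 I : 0 <= box_volume I.
Proof.
case: I => [[a b]|//] /=; rewrite lee_fin; apply: prodr_ge0 => i _.
by rewrite le_max lexx.
Qed.

Lemma lebesgue_outer_ge0 X : 0 <= lebesgue_outer X.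
Proof.
apply: le_ereal_inf_tmp => _ [I _ <-]; apply: nneseries_ge0 => k _ _.
exact: box_volume_ge0.
Qed.

Lemma lebesgue_outer0 : lebesgue_outer set0 = 0.
Proof.
apply/eqP; rewrite eq_le lebesgue_outer_ge0 andbT.
apply: ereal_inf_lbound; exists (fun=> None); first exact: sub0set.
by rewrite eseries0.
Qed.

Lemma le_lebesgue_outer : {homo lebesgue_outer : A B / A `<=` B >-> A <= B}.
Proof.
move=> A B AB; apply/ereal_inf_le_tmp => _ [I BI <-]; exists I => //.
exact: subset_trans AB BI.
Qed.

Lemma lebesgue_outer_sigma_subadditive : sigma_subadditive lebesgue_outer.
Proof.
move=> A; have [[i ioo]|] := pselect (exists i, lebesgue_outer (A i) = +oo).
  rewrite (eseries_pinfty _ _ ioo) ?leey// => n _.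
  by rewrite -ltNye (lt_le_trans _ (lebesgue_outer_ge0 _)).
rewrite -forallNE => Aoo.
suff add2e (e : {posnum R}) : lebesgue_outer (\bigcup_n A n) <=
    \sum_(i <oo) lebesgue_outer (A i) + e%:num%:E.
  by apply/lee_addgt0Pr => _/posnumP[].
rewrite (le_trans _ (epsilon_trick _ _ _))//; last first.
  by move=> n; exact: lebesgue_outer_ge0.
pose P n I := box_cover (A n) I /\
  \sum_(k <oo) box_volume (I k) <=
  lebesgue_outer (A n) + (e%:num / (2 ^ n.+1)%:R)%:E.
have [G PG] : {G & forall n, P n (G n)}.
  apply: (@choice _ _ P) => n; rewrite /P /lebesgue_outer.
  set S := (X in ereal_inf X); move infS : (ereal_inf S) => iS.
  case: iS infS => [r Sr|Soo|Soo].
  - have en1 : (0 < e%:num / (2 ^ n.+1)%:R)%R by [].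
    have /(lb_ereal_inf_adherent en1) : ereal_inf S \is a fin_num by rewrite Sr.
    move=> [x [I AnI volIx] xS].
    by exists I; split => //; rewrite volIx -Sr; exact/ltW.
  - by have := Aoo n; rewrite /lebesgue_outer Soo.
  - suff : lbound S 0 by move/le_ereal_inf_tmp; rewrite Soo.
    move=> /= _ [I AnI <-]; apply: nneseries_ge0 => k _ _.
    exact: box_volume_ge0.
have G_ge0 x : 0 <= (box_volume \o uncurry G) x by exact: box_volume_ge0.
apply: (@le_trans _ _ (\esum_(i in setT) (box_volume \o uncurry G) i)).
  apply: ereal_inf_lbound => /=.
  have /card_esym/ppcard_eqP[f] := card_nat2.
  exists (uncurry G \o f).
    apply: (@subset_trans _ (\bigcup_n \bigcup_k box (G n k))) => [t [i _]|].
      by move=> /(PG i).1 -[j _ ?]; exists i => //; exists j.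
    move=> t [i _ [j _ Bijt]]; exists (f^-1%FUN (i, j)) => //=.
    by rewrite invK ?inE.
  rewrite -(esum_pred_image (box_volume \o uncurry G) _ xpredT)
    ?[fun=> _]set_true//.
  by rewrite image_eq.
rewrite (_ : esum _ _ = \sum_(i <oo) \sum_(j <oo) box_volume (G i j));
    last first.
  pose J : nat -> set (nat * nat) := fun i => [set (i, j) | j in setT].
  rewrite (_ : setT = \bigcup_k J k); last first.
    by rewrite predeqE => -[a b]; split => // _; exists a => //; exists b.
  rewrite esum_bigcupT /=; last 2 first.
    - apply/trivIsetP => i j _ _ ij.
      rewrite predeqE => -[n m] /=; split => //= -[] [_] _ [<-{n} _].
      by move=> [m' _] [] /esym/eqP; rewrite (negbTE ij).
    - by move=> /= [n m]; exact: box_volume_ge0.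
  rewrite -(image_id [set: nat]) -fun_true esum_pred_image//; last first.
    by move=> n _; apply: esum_ge0 => t _; exact: box_volume_ge0.
  apply: eq_eseriesr => /= j _.
  rewrite -(esum_pred_image (box_volume \o uncurry G) (pair j) predT)//=.
  - congr esum; rewrite predeqE => -[a b].
    by split; move=> [i _ <-]; exists i.
  - by move=> n _; exact: box_volume_ge0.
  - by move=> ? ? _ _; exact: (@can_inj _ _ _ snd).
apply: lee_lim.
- apply: is_cvg_nneseries => n *.
  by apply: nneseries_ge0 => m *; exact: (G_ge0 (n, m)).
- by apply: is_cvg_nneseries => n *; apply: adde_ge0 => //;
    exact: lebesgue_outer_ge0.
- by near=> n; apply: lee_sum => i _; exact: (PG i).2.
Unshelve. all: by end_near. Qed.

HB.instance Definition _ := isOuterMeasure.Build R 'rV[R]_d lebesgue_outer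
  lebesgue_outer0 lebesgue_outer_ge0 le_lebesgue_outer
  lebesgue_outer_sigma_subadditive.

End lebesgue_outer_measure.

Notation Rd R d := (caratheodory_type (@lebesgue_outer R d)).

Section integration.
Context {R : realType} {d : nat}.

Definition lebesgue : {measure set (Rd R d) -> \bar R} :=
  (lebesgue_outer : {outer_measure set 'rV[R]_d -> \bar R}).

Definition is_cube (Q : set (Rd R d)) := exists (a : 'rV[R]_d) (l : R),
  0 < l /\ Q = [set x : 'rV[R]_d |
    forall i, a ord0 i <= x ord0 i <= a ord0 i + l].

Definition average (Q : set (Rd R d)) (f : Rd R d -> \bar R) : \bar R :=
  ((fine (lebesgue Q))^-1%:E * \int[lebesgue]_(x in Q) f x)%E.

Definition cmeasurable (f : Rd R d -> R[i]) :=
  measurable_fun setT (fun x => complex.Re (f x)) /\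
  measurable_fun setT (fun x => complex.Im (f x)).

Definition clocally_integrable (f : Rd R d -> R[i]) :=
  cmeasurable f /\ forall K : set 'rV[R]_d, compact K ->
    (\int[lebesgue]_(x in (K : set (Rd R d))) (Normc.normc (f x))%:E < +oo)%E.

End integration.

Section matrices.
Context {R : realType}.
Local Open Scope sesquilinear_scope.

Definition vnorm n (v : 'cV[R[i]]_n) : R :=
  Num.sqrt (\sum_i Normc.normc (v i ord0) ^+ 2).

Definition mxnorm n (A : 'M[R[i]]_n) : R :=
  sup [set vnorm (A *m v) | v in [set v : 'cV[R[i]]_n | vnorm v <= 1]].

Definition posdefmx n (A : 'M[R[i]]_n) :=
  A \is hermsymmx /\
  forall v : 'cV[R[i]]_n, v != 0 -> 0 < (v ^t* *m A *m v) ord0 ord0.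

(* A ^ s by the spectral theorem, for A positive definite: with
   A = P^-1 diag(l_1, ..., l_n) P and P unitary,
   A ^ s = P^-1 diag(l_1 ^ s, ..., l_n ^ s) P. *)
Definition mxpowR n (A : 'M[R[i]]_n) (s : R) : 'M[R[i]]_n :=
  let P := spectralmx A in
  invmx P *m
  diag_mx (map_mx (fun l : R[i] => Complex (complex.Re l `^ s) 0)
                  (spectral_diag A)) *m P.

End matrices.

Section matrix_weights.
Context {R : realType} {d : nat} (p : R).

Definition conjugate_exponent : R := p / (p - 1).

Definition matrix_weight n (W : Rd R d -> 'M[R[i]]_n) :=
  (forall i j, cmeasurable (fun x => W x i j)) /\
  {ae lebesgue, forall x, posdefmx (W x)}.

(* sup over cubes Q of avg_Q (avg_Q |K(x,y)|^p' dy)^(p/p') dx. *)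
Definition mixed_average_sup n (K : Rd R d -> Rd R d -> 'M[R[i]]_n) : \bar R :=
  ereal_sup [set average Q (fun x =>
      average Q (fun y => (mxnorm (K x y) `^ conjugate_exponent)%:E)
        `^ (p / conjugate_exponent))%E
    | Q in is_cube].

Definition Ap_char n (W : Rd R d -> 'M[R[i]]_n) : \bar R :=
  mixed_average_sup (fun x y => mxpowR (W x) p^-1 *m mxpowR (W y) (- p^-1)).

Definition Ap_weight n (W : Rd R d -> 'M[R[i]]_n) :=
  matrix_weight W /\ (Ap_char W < +oo)%E.

Definition BMO_norm n (V U B : Rd R d -> 'M[R[i]]_n) : \bar R :=
  (mixed_average_sup (fun x y =>
     mxpowR (V x) p^-1 *m (B x - B y) *m mxpowR (U y) (- p^-1)) `^ p^-1)%E.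

Definition Lp_norm n (W : Rd R d -> 'M[R[i]]_n) (f : Rd R d -> 'cV[R[i]]_n)
    : \bar R :=
  ((\int[lebesgue]_x (vnorm (mxpowR (W x) p^-1 *m f x) `^ p)%:E) `^ p^-1)%E.

Definition in_Lp n (W : Rd R d -> 'M[R[i]]_n) (f : Rd R d -> 'cV[R[i]]_n) :=
  (forall i, cmeasurable (fun x => f x i ord0)) /\ (Lp_norm W f < +oo)%E.

Definition locally_integrable_symbol n (B : Rd R d -> 'M[R[i]]_n) :=
  forall i j, clocally_integrable (fun x => B x i j).

End matrix_weights.

(* Linear operators may be partially defined (a singular integral does not act
   on every function); as usual, functions equal a.e. are identified. *)
Record linear_operator (R : realType) (d : nat) := LinearOperator {
  lo_dom : set (Rd R d -> R[i]) ;
  lo_act :> (Rd R d -> R[i]) -> Rd R d -> R[i] ;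
  lo_dom0 : lo_dom (fun=> 0) ;
  lo_domP : forall (c : R[i]) f g, lo_dom f -> lo_dom g ->
    lo_dom (fun x => c * f x + g x) ;
  lo_linear : forall (c : R[i]) f g, lo_dom f -> lo_dom g ->
    {ae lebesgue, forall x,
      lo_act (fun y => c * f y + g y) x = c * lo_act f x + lo_act g x} ;
  lo_dom_ae : forall f g, lo_dom f ->
    {ae lebesgue, forall x, f x = g x} -> lo_dom g ;
  lo_act_ae : forall f g, lo_dom f ->
    {ae lebesgue, forall x, f x = g x} ->
    {ae lebesgue, forall x, lo_act f x = lo_act g x} }.

(* Partially defined operators on C^n-valued functions, composed and
   subtracted on their natural domains. *)
Record vector_operator (R : realType) (d n : nat) := VectorOperator {
  vo_dom : set (Rd R d -> 'cV[R[i]]_n) ;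
  vo_act :> (Rd R d -> 'cV[R[i]]_n) -> Rd R d -> 'cV[R[i]]_n }.

Section vector_operators.
Context {R : realType} {d n : nat}.
Implicit Types S T : vector_operator R d n.

Definition tensorI (T : linear_operator R d) : vector_operator R d n :=
  VectorOperator
    [set f | forall i, lo_dom T (fun x => f x i ord0)]
    (fun f x => \col_i T (fun y => f y i ord0) x).

Definition mulop (B : Rd R d -> 'M[R[i]]_n) : vector_operator R d n :=
  VectorOperator setT (fun f x => B x *m f x).

Definition compop S T : vector_operator R d n :=
  VectorOperator [set f | vo_dom T f /\ vo_dom S (T f)] (fun f => S (T f)).

Definition subop S T : vector_operator R d n :=
  VectorOperator (vo_dom S `&` vo_dom T) (fun f x => S f x - T f x).

Definition commutator (B : Rd R d -> 'M[R[i]]_n) S : vector_operator R d n :=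
  subop (compop (mulop B) S) (compop S (mulop B)).

(* Least C such that S maps L^p(U) to L^p(V) with bound C; +oo if none. *)
Definition operator_norm (p : R) (U V : Rd R d -> 'M[R[i]]_n) S : \bar R :=
  ereal_inf [set C%:E | C in [set C : R | 0 <= C /\
    forall f, in_Lp p U f ->
      [/\ vo_dom S f, in_Lp p V (S f) &
          (Lp_norm p V (S f) <= C%:E * Lp_norm p U f)%E]]].

End vector_operators.

Arguments tensorI {R d} n T.

Definition lower_bound_collection (R : realType) (d : nat) (p : R) (N : nat)
    (T : 'I_N -> linear_operator R d) :=
  forall n : nat, (0 < n)%N ->
    (exists2 C : R, 0 < C & forall W : Rd R d -> 'M[R[i]]_n, matrix_weight W ->
      (Ap_char p W `^ p^-1 <=
       C%:E * \big[maxe/0]_(s < N) operator_norm p W W (tensorI n (T s)))%E) /\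
    (forall W : Rd R d -> 'M[R[i]]_n, Ap_weight p W ->
      forall s, (operator_norm p W W (tensorI n (T s)) < +oo)%E).

(* Main.v *)
Require Import Defs.
From mathcomp Require Import all_boot all_order all_algebra.
From mathcomp Require Import complex.
From mathcomp Require Import all_classical all_reals all_analysis.
From mathcomp Require Import measurable_realfun.
From mathcomp Require Import ring lra.
Import Order.TTheory GRing.Theory Num.Theory.
Import numFieldNormedType.Exports.
Set Implicit Arguments.
Unset Strict Implicit.
Unset Printing Implicit Defensive.
Local Open Scope classical_set_scope.
Local Open Scope ring_scope.

(** The commutator bound is the lower bound for matrix weights of twice the
    size, read off an off-diagonal block.

    For eps > 0 put
<<
      F = | V^(1/p)   V^(1/p) B     |        W = (F^* F)^(p/2).
          |    0      eps U^(1/p)   |,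
>>
    Then W^(1/p) = |F| differs from F by a unitary factor on the left
    ([vnorm_polar]), so W may be replaced by F in all norms.
    - The upper right block of F(x) F(y)^-1 is
      eps^-1 V^(1/p)(x) (B(x) - B(y)) U^(-1/p)(y), the BMO kernel divided by
      eps.  Hence eps^-1 BMO(B) <= [W]_Ap^(1/p) ([BMO_norm_le_Ap]).
    - Conjugating T by F gives an upper triangular operator whose diagonal
      blocks are T on L^p(V) and on L^p(U), and whose corner is eps^-1 times
      the commutator from L^p(U) to L^p(V).  So the norm of T on L^p(W) is at
      most a constant times |T|_V + |T|_U + |[B, T]|_(U,V) / eps
      ([op_bounded_block]).

    The lower bound assumed of the collection holds for every matrix weight,
    in particular for W, and yields
    BMO(B) <= C (eps (|T|_V + |T|_U) + |[B, T]|_(U,V)).  The norms on L^p(V)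
    and L^p(U) are finite because V and U are A_p weights, so letting eps tend
    to 0 leaves the commutator alone, with a constant that depends on neither
    U, V nor B.

    Two technical points take most of the space.  W has to be measurable, and
    this needs measurability of x |-> A(x)^s for a measurable positive
    definite A ([mxmeas_powR]): the real functions f for which f(A(x)) is
    measurable form an algebra that is closed under pointwise limits and
    contains the identity; it therefore contains exponentials, then
    indicators of half-lines, then powers.  On the other hand the mixed
    averages are integrals of functions whose measurability is not at hand,
    so they are compared through simple functions only
    ([ge0_le_integral_null]). *)

(** * Real functional calculus on positive definite matrices *)

Section functional_calculus.
Context {R : realType}.
Local Open Scope sesquilinear_scope.
Local Open Scope complex_scope.

Lemma conj_normc (z : R[i]) : z^* * z = ((Normc.normc z) ^+ 2)%:C.
Proof.
case: z => a b /=; rewrite sqr_sqrtr ?addr_ge0 ?sqr_ge0//.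
by apply/eqP; rewrite eq_complex /=; apply/andP; split; apply/eqP; ring.
Qed.

Definition rdiag n (w : 'rV[R]_n) : 'M[R[i]]_n :=
  diag_mx (map_mx (real_complex R) w).

(** f(A) for a real function f, in terms of the spectral decomposition chosen
    by [spectralmx]; [mxpowR] is the case of powers. *)
Definition fcalc n (f : R -> R) (A : 'M[R[i]]_n) : 'M[R[i]]_n :=
  let P := spectralmx A in
  invmx P *m
  diag_mx (map_mx (fun l : R[i] => Complex (f (complex.Re l)) 0)
                  (spectral_diag A)) *m P.

Lemma mxpowRE n (A : 'M[R[i]]_n) s : mxpowR A s = fcalc (fun t => t `^ s) A.
Proof. by []. Qed.

Lemma rdiagM n (v w : 'rV[R]_n) :
  rdiag v *m rdiag w = rdiag (\row_j (v ord0 j * w ord0 j)).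
Proof.
rewrite /rdiag mulmx_diag; congr diag_mx.
by apply/rowP => j; rewrite !mxE -rmorphM.
Qed.

Lemma quad_rdiag n (w : 'rV[R]_n) (u : 'cV[R[i]]_n) :
  (u^t* *m rdiag w *m u) ord0 ord0 =
  (\sum_j w ord0 j * Normc.normc (u j ord0) ^+ 2)%:C.
Proof.
rewrite mxE rmorph_sum /=; apply: eq_bigr => j _.
rewrite mul_mx_diag !mxE mulrAC conj_normc mulrC.
by rewrite -rmorphM.
Qed.

Lemma vnorm_sq n (u : 'cV[R[i]]_n) :
  vnorm u ^+ 2 = \sum_j Normc.normc (u j ord0) ^+ 2.
Proof. by rewrite sqr_sqrtr// sumr_ge0// => j _; rewrite sqr_ge0. Qed.

Lemma quad1 n (u : 'cV[R[i]]_n) : (u^t* *m u) ord0 ord0 = (vnorm u ^+ 2)%:C.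
Proof.
have -> : u^t* *m u = u^t* *m rdiag (const_mx 1) *m u.
  by rewrite /rdiag map_const_mx diag_const_mx mulmx1.
rewrite quad_rdiag vnorm_sq; congr (_%:C); apply: eq_bigr => j _.
by rewrite mxE mul1r.
Qed.

Lemma vnorm_ge0 n (u : 'cV[R[i]]_n) : 0 <= vnorm u.
Proof. exact: sqrtr_ge0. Qed.

Lemma vnorm_gt0 n (u : 'cV[R[i]]_n) : u != 0 -> 0 < vnorm u.
Proof.
move=> u0; rewrite lt_neqAle vnorm_ge0 andbT eq_sym; apply: contraNneq u0 => u0.
have := vnorm_sq u; rewrite u0 expr0n/= => /esym/eqP.
rewrite psumr_eq0; last by move=> j _; rewrite sqr_ge0.
move/allP => h; apply/eqP/colP => j; rewrite mxE; apply: Normc.eq0_normc.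
by have := h j; rewrite mem_index_enum /= sqrf_eq0 => /(_ isT)/eqP.
Qed.

(** Decompositions P^-1 diag(w) P are manipulated through this name, so that P
    may be any diagonalizing matrix and not only the chosen one. *)
Definition sconj n (P : 'M[R[i]]_n) (w : 'rV[R]_n) : 'M[R[i]]_n :=
  invmx P *m rdiag w *m P.

Lemma posdef_sconj n (P : 'M[R[i]]_n) (w : 'rV[R]_n) : P \is unitarymx ->
  (forall j, 0 < w ord0 j) -> posdefmx (sconj P w).
Proof.
move=> Pu w0; rewrite /sconj invmx_unitary//; split.
  apply/is_hermitianmxP; rewrite expr0 scale1r.
  rewrite 2!trmx_mul 2!map_mxM mulmxA trmxCK; congr (_ *m _ *m _).
  rewrite /rdiag tr_diag_mx map_diag_mx; congr diag_mx.
  by apply/rowP => j; rewrite !mxE; exact/esym/conjc_real.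
move=> v v0.
have -> : v^t* *m (P^t* *m rdiag w *m P) *m v =
          (P *m v)^t* *m rdiag w *m (P *m v).
  by rewrite trmx_mul map_mxM !mulmxA.
rewrite quad_rdiag ltcR.
have Pv0 : P *m v != 0.
  apply: contraNneq v0 => Pv0.
  by rewrite -(mulKmx (unitarymx_unit Pu) v) Pv0 mulmx0.
have /rV0Pn[j] : (P *m v)^T != 0 by rewrite trmx_eq0.
rewrite mxE => Pvj; rewrite (bigD1 j)//= ltr_pwDl//.
  rewrite mulr_gt0// exprn_gt0// lt_neqAle eq_sym; apply/andP; split.
    by apply: contraNneq Pvj => /Normc.eq0_normc ->.
  by case: ((P *m v) j ord0) => a b /=; rewrite sqrtr_ge0.
by rewrite sumr_ge0// => k _; rewrite mulr_ge0 ?sqr_ge0// ltW.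
Qed.

Lemma quad_unitary n (P D : 'M[R[i]]_n) (u : 'cV[R[i]]_n) : P \is unitarymx ->
  (invmx P *m u)^t* *m (invmx P *m D *m P) *m (invmx P *m u) = u^t* *m D *m u.
Proof.
move=> Pu; have PV := mulmxV (unitarymx_unit Pu).
have VP : (invmx P)^t* = P by rewrite invmx_unitary// trmxCK.
move: (invmx P) PV VP => Q PQ QP.
by rewrite trmx_mul map_mxM QP !mulmxA -2!(mulmxA _ P Q) PQ !mulmx1.
Qed.

Lemma fcalcE n (f : R -> R) (A : 'M[R[i]]_n) : fcalc f A =
  sconj (spectralmx A) (map_mx f (map_mx (@complex.Re R) (spectral_diag A))).
Proof.
rewrite /fcalc /sconj /rdiag.
set D1 := map_mx _ (spectral_diag A); set D2 := map_mx (real_complex R) _.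
suff -> : D1 = D2 by [].
by apply/rowP => j; rewrite !mxE.
Qed.

Lemma posdef_spectral n (A : 'M[R[i]]_n) : posdefmx A ->
  let w := map_mx (@complex.Re R) (spectral_diag A) in
  (forall j, 0 < w ord0 j) /\ A = sconj (spectralmx A) w.
Proof.
move=> [Ah Apos] w; set P := spectralmx A.
have Pu : P \is unitarymx := spectral_unitarymx A.
have AE : A = invmx P *m diag_mx (spectral_diag A) *m P.
  by apply/orthomx_spectralP; exact: hermitian_normalmx.
have DE : spectral_diag A = map_mx (real_complex R) w.
  apply/rowP => j; rewrite !mxE RRe_real//.
  by have /mxOverP := hermitian_spectral_diag_real Ah; apply.
split; last by rewrite /sconj /rdiag -DE; exact: AE.
move=> j; pose v : 'cV[R[i]]_n := invmx P *m delta_mx j ord0.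
have v0 : v != 0.
  apply/negP => /eqP v0; have := congr1 (mulmx P) v0.
  rewrite mulmx0 /v mulKVmx ?unitarymx_unit// => /matrixP/(_ j ord0).
  by rewrite !mxE !eqxx/= => /eqP; rewrite oner_eq0.
have := Apos v v0.
have -> : v^t* *m A *m v = (delta_mx j ord0)^t* *m rdiag w *m delta_mx j ord0.
  by rewrite /rdiag -DE {1}AE; exact: quad_unitary.
rewrite quad_rdiag ltcR (bigD1 j)//= big1 ?addr0.
  rewrite (_ : delta_mx j ord0 j ord0 = 1%C); last by rewrite mxE !eqxx.
  by rewrite Normc.normc1 expr1n mulr1.
move=> k kj; rewrite (_ : delta_mx j ord0 k ord0 = 0%C).
  by rewrite Normc.normc0 expr0n mulr0.
by rewrite mxE (negbTE kj).
Qed.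

(** f(A) does not depend on the diagonalization: the change of basis M = P Q^-1
    satisfies w_i M_ij = M_ij v_j, so w_i = v_j, and therefore f(w_i) = f(v_j),
    wherever M_ij is nonzero. *)
Lemma sconj_diag n (P Q : 'M[R[i]]_n) (v w : 'rV[R]_n) (f : R -> R) :
  P \in unitmx -> Q \in unitmx -> sconj P w = sconj Q v ->
  sconj P (map_mx f w) = sconj Q (map_mx f v).
Proof.
rewrite /sconj => Pu Qu.
move: (mulmxV Pu) (mulVmx Pu) (mulmxV Qu) (mulVmx Qu).
move: (invmx P) (invmx Q) => P' Q' PP' P'P QQ' Q'Q.
move=> /(congr1 (fun X => P *m X *m Q')).
rewrite !mulmxA PP' mul1mx -(mulmxA _ Q Q') QQ' mulmx1.
rewrite -(mulmxA _ P Q'); have [M ME] : {M | M = P *m Q'} by exists (P *m Q').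
rewrite -ME => hM.
have hfM : rdiag (map_mx f w) *m M = M *m rdiag (map_mx f v).
  apply/matrixP => i j; have /matrixP/(_ i j) := hM.
  rewrite !mul_diag_mx !mul_mx_diag !mxE.
  have [->|M0] := eqVneq (M i j) 0; first by rewrite !mulr0 !mul0r.
  move=> h; have /complexI -> : (w 0 i)%:C = (v 0 j)%:C.
    by apply: (mulIf M0); rewrite h mulrC.
  by rewrite mulrC.
have := congr1 (fun X => P' *m X *m Q) hfM; rewrite ME !mulmxA P'P mul1mx.
by rewrite -(mulmxA _ Q' Q) Q'Q mulmx1.
Qed.

Lemma fcalc_diag n (f : R -> R) (A P : 'M[R[i]]_n) (w : 'rV[R]_n) :
  posdefmx A -> P \in unitmx -> A = sconj P w ->
  fcalc f A = sconj P (map_mx f w).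
Proof.
move=> /posdef_spectral[_ AE'] Pu AE; rewrite fcalcE.
by apply: sconj_diag; rewrite ?spectral_unit// -AE'.
Qed.

Lemma fcalc_posdef n (f : R -> R) (A : 'M[R[i]]_n) : posdefmx A ->
  (forall t, 0 < t -> 0 < f t) -> posdefmx (fcalc f A).
Proof.
move=> /posdef_spectral[w0 _] f0; rewrite fcalcE.
by apply: posdef_sconj; [exact: spectral_unitarymx|move=> j; rewrite mxE f0].
Qed.

(** The matrix f(A) comes with its own chosen decomposition, which need not be
    that of A; [fcalc_diag] reconciles the two. *)
Lemma fcalc_comp n (f g : R -> R) (A : 'M[R[i]]_n) : posdefmx A ->
  (forall t, 0 < t -> 0 < f t) -> fcalc g (fcalc f A) = fcalc (g \o f) A.
Proof.
move=> Apos f0.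
rewrite (fcalc_diag g (fcalc_posdef Apos f0) (spectral_unit A) (fcalcE f A)).
rewrite [RHS]fcalcE; congr sconj.
by apply/rowP => j; rewrite !mxE.
Qed.

Lemma sconjM n (P : 'M[R[i]]_n) (v w : 'rV[R]_n) : P \in unitmx ->
  sconj P v *m sconj P w = sconj P (\row_j (v ord0 j * w ord0 j)).
Proof.
rewrite /sconj => /mulmxV; move: (invmx P) => P' PP'.
by rewrite -rdiagM !mulmxA -(mulmxA _ P P') PP' mulmx1.
Qed.

Lemma sconjD n (P : 'M[R[i]]_n) (v w : 'rV[R]_n) :
  sconj P v + sconj P w = sconj P (v + w).
Proof.
rewrite /sconj -mulmxDl -mulmxDr.
suff -> : rdiag v + rdiag w = rdiag (v + w) by [].
apply/matrixP => i j; rewrite !mxE -mulrnDl; congr (_ *+ _).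
by rewrite -rmorphD.
Qed.

Lemma sconj_const n (P : 'M[R[i]]_n) (c : R) : P \in unitmx ->
  sconj P (const_mx c) = (c%:C)%:M.
Proof.
move=> Pu; rewrite /sconj /rdiag map_const_mx diag_const_mx scalar_mxC.
by rewrite -mulmxA mulVmx// mulmx1.
Qed.

Lemma fcalcM n (f g : R -> R) (A : 'M[R[i]]_n) :
  fcalc (fun t => f t * g t) A = fcalc f A *m fcalc g A.
Proof.
rewrite !fcalcE (sconjM _ _ (spectral_unit A)); congr sconj.
by apply/rowP => j; rewrite !mxE.
Qed.

Lemma fcalcD n (f g : R -> R) (A : 'M[R[i]]_n) :
  fcalc (fun t => f t + g t) A = fcalc f A + fcalc g A.
Proof.
rewrite !fcalcE sconjD; congr sconj.
by apply/rowP => j; rewrite !mxE.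
Qed.

Lemma fcalc_cst n (c : R) (A : 'M[R[i]]_n) : fcalc (fun=> c) A = (c%:C)%:M.
Proof.
rewrite -(sconj_const c (spectral_unit A)) fcalcE; congr sconj.
by apply/rowP => j; rewrite !mxE.
Qed.

Lemma fcalc_id n (A : 'M[R[i]]_n) : posdefmx A -> fcalc id A = A.
Proof.
by move=> /posdef_spectral[_ AE]; rewrite fcalcE [RHS]AE map_mx_id.
Qed.

Lemma eq_fcalc n (f g : R -> R) (A : 'M[R[i]]_n) : posdefmx A ->
  (forall t, 0 < t -> f t = g t) -> fcalc f A = fcalc g A.
Proof.
move=> /posdef_spectral[w0 _] fg; rewrite !fcalcE; congr sconj.
by apply/rowP => j; rewrite !mxE fg//; have := w0 j; rewrite mxE.
Qed.

Lemma mxpowR_posdef n (A : 'M[R[i]]_n) s : posdefmx A -> posdefmx (mxpowR A s).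
Proof.
move=> Apos; rewrite mxpowRE; apply: (fcalc_posdef Apos) => t.
exact: powR_gt0.
Qed.

Lemma mxpowRM n (A : 'M[R[i]]_n) s t : posdefmx A ->
  mxpowR (mxpowR A s) t = mxpowR A (s * t).
Proof.
move=> Apos; have s0 (u : R) : 0 < u -> 0 < u `^ s by exact: powR_gt0.
rewrite !mxpowRE (fcalc_comp _ Apos s0).
by apply: eq_fcalc => // u u0 /=; rewrite powRrM.
Qed.

Lemma mxpowRD n (A : 'M[R[i]]_n) s t : posdefmx A ->
  mxpowR A s *m mxpowR A t = mxpowR A (s + t).
Proof.
move=> Apos; rewrite !mxpowRE -fcalcM; apply: eq_fcalc => // u u0.
by rewrite powRD// (gt_eqF u0) implybT.
Qed.

Lemma mxpowR0 n (A : 'M[R[i]]_n) : mxpowR A 0 = 1%:M.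
Proof.
rewrite mxpowRE (_ : (fun t : R => t `^ 0) = fun=> 1) ?fcalc_cst//.
by apply/funext => t; rewrite powRr0.
Qed.

Lemma mxpowR1 n (A : 'M[R[i]]_n) : posdefmx A -> mxpowR A 1 = A.
Proof.
move=> Apos; rewrite mxpowRE -[RHS](fcalc_id Apos); apply: (eq_fcalc Apos).
by move=> t t0; rewrite powRr1// ltW.
Qed.

End functional_calculus.

(** * Measurability of complex and matrix valued functions *)

Lemma measurable_fun_powR {dd} {X : measurableType dd} {R : realType}
    (f : X -> R) r : measurable_fun setT f ->
  measurable_fun setT (fun x => f x `^ r).
Proof.
move=> mf; exact: (@measurableT_comp _ _ _ _ _ _ (fun t => t `^ r) _ f
  (measurable_powR r) mf).
Qed.

Section complex_measurability.
Context {R : realType} {d : nat}.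
Local Open Scope complex_scope.
Implicit Types f g : Rd R d -> R[i].

Lemma ReD (x y : R[i]) : complex.Re (x + y) = complex.Re x + complex.Re y.
Proof. by case: x; case: y. Qed.
Lemma ImD (x y : R[i]) : complex.Im (x + y) = complex.Im x + complex.Im y.
Proof. by case: x; case: y. Qed.
Lemma ReM (x y : R[i]) : complex.Re (x * y) =
  complex.Re x * complex.Re y - complex.Im x * complex.Im y.
Proof. by case: x; case: y. Qed.
Lemma ImM (x y : R[i]) : complex.Im (x * y) =
  complex.Re x * complex.Im y + complex.Im x * complex.Re y.
Proof. by case: x; case: y. Qed.

Lemma cmeas_cst (c : R[i]) : @cmeasurable R d (fun=> c).
Proof. by split; exact: measurable_cst. Qed.

Lemma cmeasD f g : cmeasurable f -> cmeasurable g ->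
  cmeasurable (fun x => f x + g x).
Proof.
move=> [f1 f2] [g1 g2]; split.
  by under eq_fun do rewrite ReD; exact: measurable_funD.
by under eq_fun do rewrite ImD; exact: measurable_funD.
Qed.

Lemma cmeasM f g : cmeasurable f -> cmeasurable g ->
  cmeasurable (fun x => f x * g x).
Proof.
move=> [f1 f2] [g1 g2]; split.
  under eq_fun do rewrite ReM.
  by apply: measurable_funB; exact: measurable_funM.
under eq_fun do rewrite ImM.
by apply: measurable_funD; exact: measurable_funM.
Qed.

Lemma cmeas_sum (I : Type) (s : seq I) (F : I -> Rd R d -> R[i]) :
  (forall i, cmeasurable (F i)) -> cmeasurable (fun x => \sum_(i <- s) F i x).
Proof.
move=> mF; elim: s => [|i s IH].
  by under eq_fun do rewrite big_nil; exact: cmeas_cst.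
by under eq_fun do rewrite big_cons; exact: cmeasD.
Qed.

Lemma cmeas_conj f : cmeasurable f -> cmeasurable (fun x => Num.conj (f x)).
Proof.
move=> [f1 f2]; split.
  rewrite (_ : (fun x => _) = (fun x => complex.Re (f x)))//.
  by apply/funext => x; case: (f x).
rewrite (_ : (fun x => _) = (fun x => - complex.Im (f x))).
  exact: measurable_funN.
by apply/funext => x; case: (f x).
Qed.

Lemma measurable_normc f : cmeasurable f ->
  measurable_fun setT (fun x => Normc.normc (f x)).
Proof.
move=> [f1 f2].
rewrite (_ : (fun x => _) = (fun x =>
    (complex.Re (f x) ^+ 2 + complex.Im (f x) ^+ 2) `^ 2^-1)).
  apply: measurable_fun_powR.
  by apply: measurable_funD; exact: measurable_funX.
apply/funext => x; rewrite powR12_sqrt; last by rewrite addr_ge0// sqr_ge0.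
by case: (f x).
Qed.

(** Holds because the Caratheodory measure is complete. *)
Lemma cmeas_ae f g : cmeasurable f -> {ae lebesgue, forall x, f x = g x} ->
  cmeasurable g.
Proof.
have cpl : measure_is_complete (@lebesgue R d).
  exact: measure_is_complete_caratheodory.
move=> [/measurable_EFinP f1 /measurable_EFinP f2] fg.
split; apply/measurable_EFinP.
  by apply: (ae_measurable_fun cpl _ f1); apply: filterS fg => x /= -> _.
by apply: (ae_measurable_fun cpl _ f2); apply: filterS fg => x /= -> _.
Qed.

End complex_measurability.

Section matrix_measurability.
Context {R : realType} {d : nat}.
Local Open Scope complex_scope.
Local Open Scope sesquilinear_scope.

Definition mxmeasurable m n (A : Rd R d -> 'M[R[i]]_(m, n)) :=
  forall i j, cmeasurable (fun x => A x i j).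

Lemma mxmeas_ext m n (A B : Rd R d -> 'M[R[i]]_(m, n)) :
  (forall x, A x = B x) -> mxmeasurable A -> mxmeasurable B.
Proof. by move=> /funext ->. Qed.

Lemma mxmeas_cst m n (A : 'M[R[i]]_(m, n)) : mxmeasurable (fun=> A).
Proof. by move=> i j; exact: cmeas_cst. Qed.

Lemma mxmeasM m n k (A : Rd R d -> 'M[R[i]]_(m, n))
    (B : Rd R d -> 'M[R[i]]_(n, k)) : mxmeasurable A -> mxmeasurable B ->
  mxmeasurable (fun x => A x *m B x).
Proof.
move=> mA mB i j; under eq_fun do rewrite mxE.
by apply: cmeas_sum => l; exact: cmeasM.
Qed.

Lemma mxmeasD m n (A B : Rd R d -> 'M[R[i]]_(m, n)) :
  mxmeasurable A -> mxmeasurable B -> mxmeasurable (fun x => A x + B x).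
Proof. by move=> mA mB i j; under eq_fun do rewrite mxE; exact: cmeasD. Qed.

Lemma mxmeasZ m n c (A : Rd R d -> 'M[R[i]]_(m, n)) :
  mxmeasurable A -> mxmeasurable (fun x => c *: A x).
Proof.
move=> mA i j; under eq_fun do rewrite mxE.
by apply: cmeasM => //; exact: cmeas_cst.
Qed.

Lemma mxmeas_adj m n (A : Rd R d -> 'M[R[i]]_(m, n)) :
  mxmeasurable A -> mxmeasurable (fun x => (A x)^t*).
Proof. by move=> mA i j; under eq_fun do rewrite !mxE; exact: cmeas_conj. Qed.

Lemma mxmeas_ae m n (A B : Rd R d -> 'M[R[i]]_(m, n)) : mxmeasurable A ->
  {ae lebesgue, forall x, A x = B x} -> mxmeasurable B.
Proof.
by move=> mA AB i j; apply: cmeas_ae (mA i j) _; apply: filterS AB => x /= ->.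
Qed.

Lemma measurable_vnorm n (f : Rd R d -> 'cV[R[i]]_n) :
  (forall i, cmeasurable (fun x => f x i ord0)) ->
  measurable_fun setT (fun x => vnorm (f x)).
Proof.
move=> mf; rewrite /vnorm.
rewrite (_ : (fun x => _) = (fun x =>
    (\sum_i Normc.normc (f x i ord0) ^+ 2) `^ 2^-1)).
  apply: measurable_fun_powR.
  apply: measurable_sum => i; apply: measurable_funX.
  exact: measurable_normc.
apply/funext => x; rewrite powR12_sqrt// sumr_ge0// => i _.
exact: sqr_ge0.
Qed.

End matrix_measurability.

Section steps.
Context {R : realType}.

Lemma cvg_eqfun (u v : nat -> R) (l m : R) : (forall k, u k = v k) -> m = l ->
  v k @[k --> \oo] --> l -> u k @[k --> \oo] --> m.
Proof. by move=> /funext -> ->. Qed.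

(** A soft threshold at c obtained from an entire function of t; its limit
    at t = c lies strictly between 0 and 1. *)
Lemma cvg_exp_step (t c : R) : 0 < t -> 0 < c -> forall e : R,
  e = (if t < c then 1 else if t == c then expR (- 1) else 0) ->
  expR (- (t / c) ^+ k) @[k --> \oo] --> e.
Proof.
move=> t0 c0 e ->; have tc0 : 0 < t / c by rewrite divr_gt0.
case: ltgtP => [tc|tc|->].
- rewrite -expR0 -[in X in _ --> expR X]oppr0.
  apply: continuous_cvg; first exact: continuous_expR.
  apply: cvgN; apply: cvg_expr.
  by rewrite gtr0_norm// ltr_pdivrMr// mul1r.
- apply: (@squeeze_cvgr _ _ _ _ (fun=> 0) (fun k => (c / t) ^+ k)).
  + near=> k; rewrite expR_ge0/= expRN -[leRHS]invrK lef_pV2 ?posrE ?expR_gt0//.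
      rewrite -exprVn invf_div.
      by apply: le_trans (expR_ge1Dx _); rewrite lerDr.
    by rewrite invr_gt0 exprn_gt0// divr_gt0.
  + exact: cvg_cst.
  + by apply: cvg_expr; rewrite gtr0_norm ?divr_gt0// ltr_pdivrMr// mul1r.
- rewrite (_ : (fun k => _) = fun=> expR (- 1)); first exact: cvg_cst.
  by apply/funext => k; rewrite divff ?gt_eqF// expr1n.
Unshelve. all: by end_near. Qed.

(** The thresholds (j+1)/K lying below y number about K y: a staircase of
    step 1/K approximates y from below within 1/K as long as y <= n/K.  The
    first conjunct is what makes the induction on n go through. *)
Lemma stair_bound (y K : R) n : 0 < K -> 0 < y ->
  let S := \sum_(j < n) K^-1 * (if j.+1%:R / K < y then 1 else 0) in
  (n%:R / K < y -> S = n%:R / K) /\ (y <= n%:R / K -> y - K^-1 <= S <= y).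
Proof.
move=> K0 y0 /=; have Ki : 0 < K^-1 by rewrite invr_gt0.
elim: n => [|n [IH1 IH2]].
  by rewrite big_ord0 mul0r; split => // y1; move: y0; rewrite ltNge y1.
rewrite big_ord_recr/= -natr1 mulrDl mul1r.
have [h|h] := ltP (n%:R / K + K^-1) y; split => // h'.
  by rewrite IH1 ?mulr1//; apply: lt_trans h; rewrite ltrDl.
rewrite mulr0 addr0; have [ny|ny] := ltP (n%:R / K) y; last exact: IH2.
by rewrite IH1//; apply/andP; split; [rewrite lerBlDr|exact: ltW].
Qed.

End steps.

(** * Measurability of powers of a matrix weight *)

#[local] Opaque fcalc.

Section measurable_functional_calculus.
Context {R : realType} {d n : nat}.
Variable A : Rd R d -> 'M[R[i]]_n.
Hypothesis mA : mxmeasurable A.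
Hypothesis Apos : forall x, posdefmx (A x).
Local Open Scope complex_scope.

(** The class of functions to be shown to contain the powers. *)
Definition fmeas (f : R -> R) := mxmeasurable (fun x => fcalc f (A x)).

(** The entries of f(A) are linear in f, with coefficients that depend on A
    alone; this turns pointwise convergence of functions into entrywise
    convergence of matrices. *)
Lemma fcalc_entry (M : 'M[R[i]]_n) i j : posdefmx M ->
  exists (w : 'I_n -> R) (c : 'I_n -> R[i]), (forall k, 0 < w k) /\
  forall f : R -> R, fcalc f M i j = \sum_k (f (w k))%:C * c k.
Proof.
move=> /posdef_spectral[w0 _].
exists (fun k => complex.Re (spectral_diag M ord0 k)),
  (fun k => invmx (spectralmx M) i k * spectralmx M k j).
split=> [k|f]; first by have := w0 k; rewrite mxE.
rewrite fcalcE mxE; apply: eq_bigr => k _.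
by rewrite mul_mx_diag !mxE mulrAC mulrC.
Qed.

Lemma fmeas_cvg (f : nat -> R -> R) g : (forall k, fmeas (f k)) ->
  (forall t, 0 < t -> f k t @[k --> \oo] --> g t) -> fmeas g.
Proof.
move=> mf fg i j; split.
- apply: (@measurable_fun_cvg _ _ _ _
    (fun k x => complex.Re (fcalc (f k) (A x) i j))).
    by move=> k; have [] := mf k i j.
  move=> x _; have [w [c [w0 wE]]] := fcalc_entry i j (Apos x).
  have ReE h : complex.Re (fcalc h (A x) i j) =
      \sum_k h (w k) * complex.Re (c k).
    rewrite wE (big_morph _ ReD erefl); apply: eq_bigr => k _.
    by rewrite ReM mul0r subr0.
  apply: (cvg_eqfun (fun k => ReE (f k)) (ReE g)).
  apply: cvg_big => [|k _]; first exact: add_continuous.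
  by apply: cvgMl; exact: fg.
- apply: (@measurable_fun_cvg _ _ _ _
    (fun k x => complex.Im (fcalc (f k) (A x) i j))).
    by move=> k; have [] := mf k i j.
  move=> x _; have [w [c [w0 wE]]] := fcalc_entry i j (Apos x).
  have ImE h : complex.Im (fcalc h (A x) i j) =
      \sum_k h (w k) * complex.Im (c k).
    rewrite wE (big_morph _ ImD erefl); apply: eq_bigr => k _.
    by rewrite ImM mul0r addr0.
  apply: (cvg_eqfun (fun k => ImE (f k)) (ImE g)).
  apply: cvg_big => [|k _]; first exact: add_continuous.
  by apply: cvgMl; exact: fg.
Qed.

Lemma eq_fmeas f g : (forall t, 0 < t -> f t = g t) -> fmeas f -> fmeas g.
Proof. by move=> fg; apply: mxmeas_ext => x; exact: eq_fcalc. Qed.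

Lemma fmeas_cst c : fmeas (fun=> c).
Proof.
apply: (mxmeas_ext (fun x => esym (fcalc_cst c (A x)))).
exact: mxmeas_cst.
Qed.

Lemma fmeasD f g : fmeas f -> fmeas g -> fmeas (fun t => f t + g t).
Proof.
move=> mf mg; apply: (mxmeas_ext (fun x => esym (fcalcD f g (A x)))).
exact: mxmeasD mf mg.
Qed.

Lemma fmeasM f g : fmeas f -> fmeas g -> fmeas (fun t => f t * g t).
Proof.
move=> mf mg; apply: (mxmeas_ext (fun x => esym (fcalcM f g (A x)))).
exact: mxmeasM mf mg.
Qed.

Lemma fmeas_id : fmeas id.
Proof. exact: (mxmeas_ext (fun x => esym (fcalc_id (Apos x))) mA). Qed.

Lemma fmeasX f k : fmeas f -> fmeas (fun t => f t ^+ k).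
Proof.
move=> mf; elim: k => [|k IH]; first exact: fmeas_cst.
by apply: eq_fmeas (fmeasM mf IH) => t _; rewrite exprS.
Qed.

Lemma fmeas_sum k (F : nat -> R -> R) : (forall j, fmeas (F j)) ->
  fmeas (fun t => \sum_(j < k) F j t).
Proof.
move=> mF; elim: k => [|k IH].
  by apply: eq_fmeas (fmeas_cst 0) => t _; rewrite big_ord0.
by apply: eq_fmeas (fmeasD IH (mF k)) => t _; rewrite big_ord_recr.
Qed.

Lemma fmeas_exp f : fmeas f -> fmeas (fun t => expR (f t)).
Proof.
move=> mf; apply: (@fmeas_cvg (fun k t => series (exp_coeff (f t)) k)).
  move=> k; apply: (@eq_fmeas (fun t => \sum_(j < k) f t ^+ j * (j`!%:R)^-1)).
    by move=> t _; rewrite /series/= big_mkord.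
  apply: (@fmeas_sum k (fun j t => f t ^+ j * (j`!%:R)^-1)) => j.
  by apply: fmeasM; [exact: fmeasX|exact: fmeas_cst].
move=> t _; exact: is_cvg_series_exp_coeff.
Qed.

(** Powers of 1 minus the soft threshold kill its intermediate value at
    t = c and give the exact indicator. *)
Lemma fmeas_step c : 0 < c -> fmeas (fun t => if c < t then 1 else 0).
Proof.
move=> c0.
have m1 : fmeas (fun t =>
    if t < c then 1 else if t == c then expR (- 1) else 0).
  apply: (@fmeas_cvg (fun k t => expR (- (t / c) ^+ k))).
    move=> k; apply: fmeas_exp.
    apply: (@eq_fmeas (fun t => - 1 * (t * c^-1) ^+ k)).
      by move=> t _; rewrite mulN1r.
    apply: fmeasM; [exact: fmeas_cst|apply: fmeasX].
    by apply: fmeasM; [exact: fmeas_id|exact: fmeas_cst].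
  by move=> t t0; exact: cvg_exp_step.
apply: (@fmeas_cvg (fun k t => (1 + (-1) *
    (if t < c then 1 else if t == c then expR (- 1) else 0)) ^+ k)).
  move=> k; apply: fmeasX; apply: fmeasD; first exact: fmeas_cst.
  exact: fmeasM (fmeas_cst _) m1.
move=> t t0; case: ltgtP => tc.
- by rewrite mulr1 subrr; apply: cvg_expr; rewrite normr0 ltr01.
- rewrite mulr0 addr0 (_ : (fun k => _) = fun=> 1); first exact: cvg_cst.
  by apply/funext => k; rewrite expr1n.
- apply: cvg_expr; rewrite mulN1r ger0_norm; last first.
    by rewrite subr_ge0 -[leRHS]expR0 ler_expR lerN10.
  by rewrite ltrBlDr ltrDl expR_gt0.
Qed.

(** Staircase approximation of t^s: comparing t^s with a threshold amounts to
    comparing t with the threshold raised to 1/s. *)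
Lemma fmeas_powR s : 0 < s -> fmeas (fun t => t `^ s).
Proof.
move=> s0; pose c (k j : nat) : R := (j.+1%:R / k.+1%:R) `^ s^-1.
have c0 k j : 0 < c k j by rewrite powR_gt0// divr_gt0.
have cE k j t : 0 < t -> (c k j < t) = (j.+1%:R / k.+1%:R < t `^ s).
  move=> t0; set y := _ / _; have y0 : 0 < y by rewrite divr_gt0.
  have yE : (y `^ s^-1) `^ s = y 
    by rewrite -powRrM mulVf ?gt_eqF// powRr1// ltW.
  rewrite /c -/y; apply/idP/idP => [yt|].
    rewrite -[ltLHS]yE; apply: gt0_ltr_powR => //.
    - by rewrite nnegrE powR_ge0.
    - by rewrite nnegrE ltW.
  apply: contraLR; rewrite -!leNgt => ty.
  rewrite -[leRHS]yE; apply: (ge0_ler_powR (ltW s0)) => //.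
  - by rewrite nnegrE ltW.
  - by rewrite nnegrE powR_ge0.
pose F (k : nat) t := \sum_(j < (k.+1 * k.+1)%N)
   k.+1%:R^-1 * (if c k j < t then 1 else 0) : R.
apply: (@fmeas_cvg F).
  move=> k; apply: (@fmeas_sum (k.+1 * k.+1)%N
    (fun j t => k.+1%:R^-1 * (if c k j < t then 1 else 0))) => j.
  by apply: fmeasM; [exact: fmeas_cst|exact: fmeas_step].
move=> t t0; set y := t `^ s; have y0 : 0 < y by rewrite powR_gt0.
apply: (@squeeze_cvgr _ _ _ _ (fun k => y - harmonic k) (fun=> y)).
- near=> k; rewrite /F; under eq_bigr do rewrite cE//.
  have [_] := @stair_bound R y k.+1%:R (k.+1 * k.+1) (ltr0Sn _ _) y0.
  apply; rewrite natrM mulfK ?pnatr_eq0//.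
  rewrite (@le_trans _ _ k%:R) ?ler_nat//; near: k.
  exact: nbhs_infty_ger.
- rewrite -[X in _ --> X]subr0; apply: cvgB; first exact: cvg_cst.
  exact: cvg_harmonic.
- exact: cvg_cst.
Unshelve. all: by end_near. Qed.

End measurable_functional_calculus.

(** Positive definiteness is only known almost everywhere, so the matrix is
    first replaced by the identity on the exceptional null set. *)
Lemma mxmeas_powR (R : realType) (d n : nat) (A : Rd R d -> 'M[R[i]]_n) s :
  0 < s -> mxmeasurable A -> {ae lebesgue, forall x, posdefmx (A x)} ->
  mxmeasurable (fun x => mxpowR (A x) s).
Proof.
move=> s0 mA Apos.
pose A' x := if pselect (posdefmx (A x)) then A x else 1%:M.
have AA' : {ae lebesgue, forall x, A x = A' x}.
  by apply: filterS Apos => x xpos; rewrite /A'; case: pselect.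
have A'pos x : posdefmx (A' x).
  rewrite /A'; case: (pselect (posdefmx (A x))) => [//|nA].
  have -> : 1%:M = sconj (spectralmx 0) (const_mx 1) :> 'M[R[i]]_n.
    by rewrite (sconj_const _ (spectral_unit _)).
  by apply: (posdef_sconj (spectral_unitarymx _)) => j; rewrite mxE.
have mA' : mxmeasurable A' by exact: mxmeas_ae mA AA'.
apply: mxmeas_ae (fmeas_powR mA' A'pos s0) _.
by apply: filterS AA' => x ->.
Qed.

#[local] Opaque mxpowR.

(** * Comparison of lower integrals *)

Section lower_integral.
Local Open Scope ereal_scope.
Context d (T : measurableType d) (R : realType).
Variable mu : {measure set T -> \bar R}.
Import HBNNSimple.

(** Monotonicity of the integral as a supremum over simple functions: a simple
    function below f, multiplied by r and cut off on N, lies below g and has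
    r times the integral.  This reaches the mixed averages, whose integrands
    are arbitrary functions. *)
Lemma ge0_le_integral_null (D N : set T) (f g : T -> \bar R) (r : R) :
  (0 < r)%R -> (forall x, 0 <= f x) -> (forall x, 0 <= g x) ->
  measurable N -> mu N = 0 -> (forall x, ~ N x -> r%:E * f x <= g x) ->
  r%:E * \int[mu]_(x in D) f x <= \int[mu]_(x in D) g x.
Proof.
move=> r0 f0 g0 mN N0 fg.
rewrite -lee_pdivlMl// ge0_integralE//; apply: ge_ereal_sup => _ [h /= hf <-].
rewrite lee_pdivlMl//.
have mCN := measurableC mN.
pose h1 := scale_nnsfun h (ltW r0); pose h2 := proj_nnsfun h1 mCN.
have -> : r%:E * sintegral mu h = sintegral mu h2.
  rewrite -sintegralrM.
  have E (k : {nnsfun T >-> R}) : sintegral mu k = \int[mu]_x (k x)%:E.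
    by rewrite (integral_nnsfun _ measurableT) patch_setT.
  rewrite (E h1 : sintegral mu (cst r \* h)%R = _) (E h2).
  apply: ae_eq_integral => //.
  - exact/measurable_EFinP.
  - exact/measurable_EFinP.
  exists N; split => // x /= nx; apply: contra_notP nx => Nx _.
  by rewrite mindicE mem_set// mulr1.
rewrite ge0_integralE//; apply: ereal_sup_ubound; exists h2 => //= x.
rewrite mindicE /patch; have := hf x; rewrite /patch.
have [xN|xN] := boolP (x \in ~` N); last first.
  by rewrite mulr0 => _; case: ifP.
rewrite mulr1; case: ifP => xD hx.
  apply: le_trans (fg x _); last by move: xN; rewrite inE.
  by rewrite EFinM lee_pmul2l.
apply: (@le_trans _ _ (r%:E * 0)); last by rewrite mule0.
by rewrite EFinM lee_pmul2l.
Qed.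

End lower_integral.

(** * Euclidean norm and operator norm *)

Section operator_norm_of_matrices.
Context {R : realType}.
Local Open Scope complex_scope.

Lemma normc_ge0 (z : R[i]) : 0 <= Normc.normc z.
Proof. by case: z => a b /=; exact: sqrtr_ge0. Qed.

Lemma normc_sum (I : Type) (s : seq I) (F : I -> R[i]) :
  Normc.normc (\sum_(i <- s) F i) <= \sum_(i <- s) Normc.normc (F i).
Proof.
elim: s => [|i s IH]; first by rewrite !big_nil Normc.normc0.
rewrite !big_cons; apply: le_trans (le_normcD _ _) _.
by rewrite lerD2l.
Qed.

Lemma vnorm0 n : vnorm (0 : 'cV[R[i]]_n) = 0.
Proof.
rewrite /vnorm big1 ?sqrtr0// => i _.
by rewrite mxE Normc.normc0 expr0n.
Qed.

Lemma ler_vnorm m n (u : 'cV[R[i]]_m) (v : 'cV[R[i]]_n) :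
  (vnorm u <= vnorm v) = (vnorm u ^+ 2 <= vnorm v ^+ 2).
Proof. by rewrite ler_sqr// nnegrE vnorm_ge0. Qed.

Lemma vnormZ n (c : R) (v : 'cV[R[i]]_n) : 0 <= c ->
  vnorm (c%:C *: v) = c * vnorm v.
Proof.
move=> c0; apply/eqP.
rewrite -(@eqrXn2 _ 2)// ?vnorm_ge0 ?mulr_ge0 ?vnorm_ge0//.
rewrite exprMn !vnorm_sq mulr_sumr; apply/eqP/eq_bigr => j _.
by rewrite mxE Normc.normcM exprMn /= expr0n/= addr0 sqr_sqrtr// sqr_ge0.
Qed.

Lemma vnorm_col_mx m n (u : 'cV[R[i]]_m) (v : 'cV[R[i]]_n) :
  vnorm (col_mx u v) ^+ 2 = vnorm u ^+ 2 + vnorm v ^+ 2.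
Proof.
rewrite !vnorm_sq big_split_ord/=; congr (_ + _); apply: eq_bigr => j _.
  by rewrite col_mxEu.
by rewrite col_mxEd.
Qed.

Lemma vnorm_colu m n (u : 'cV[R[i]]_m) (v : 'cV[R[i]]_n) :
  vnorm u <= vnorm (col_mx u v).
Proof. by rewrite ler_vnorm vnorm_col_mx lerDl sqr_ge0. Qed.

Lemma vnorm_cold m n (u : 'cV[R[i]]_m) (v : 'cV[R[i]]_n) :
  vnorm v <= vnorm (col_mx u v).
Proof. by rewrite ler_vnorm vnorm_col_mx lerDr sqr_ge0. Qed.

Lemma vnorm_col0 m n (v : 'cV[R[i]]_n) :
  vnorm (col_mx (0 : 'cV[R[i]]_m) v) = vnorm v.
Proof.
apply/eqP; rewrite -(@eqrXn2 _ 2)// ?vnorm_ge0//.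
by rewrite vnorm_col_mx vnorm0 expr0n add0r.
Qed.

Lemma vnorm_coord n (v : 'cV[R[i]]_n) j : Normc.normc (v j ord0) <= vnorm v.
Proof.
rewrite -ler_sqr ?nnegrE ?vnorm_ge0 ?normc_ge0// vnorm_sq (bigD1 j)//= lerDl.
by rewrite sumr_ge0// => k _; exact: sqr_ge0.
Qed.

(** Makes the supremum that defines the operator norm meaningful. *)
Lemma mxnorm_bounded n (A : 'M[R[i]]_n) :
  exists c, forall v : 'cV[R[i]]_n, vnorm v <= 1 -> vnorm (A *m v) <= c.
Proof.
pose c := \sum_i (\sum_j Normc.normc (A i j)) ^+ 2.
exists (Num.sqrt c) => v v1; rewrite /vnorm ler_sqrt; last first.
  by rewrite sumr_ge0// => i _; exact: sqr_ge0.
apply: ler_sum => i _.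
rewrite ler_sqr ?nnegrE ?normc_ge0 ?sumr_ge0//; last first.
  by move=> j _; exact: normc_ge0.
rewrite mxE; apply: le_trans (normc_sum _ _) _; apply: ler_sum => j _.
rewrite Normc.normcM ler_piMr ?normc_ge0//.
exact: le_trans (vnorm_coord v j) v1.
Qed.

Lemma mxnorm_ub n (A : 'M[R[i]]_n) (v : 'cV[R[i]]_n) : vnorm v <= 1 ->
  vnorm (A *m v) <= mxnorm A.
Proof.
move=> v1; apply: ub_le_sup; last by exists v.
by have [c hc] := mxnorm_bounded A; exists c => _ [w w1 <-]; exact: hc.
Qed.

Lemma mxnorm_le n (A : 'M[R[i]]_n) c :
  (forall v : 'cV[R[i]]_n, vnorm v <= 1 -> vnorm (A *m v) <= c) ->
  mxnorm A <= c.
Proof.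
move=> h; apply: ge_sup.
  by exists (vnorm (A *m 0)), 0 => //=; rewrite vnorm0 ler01.
by move=> _ [v v1 <-]; exact: h.
Qed.

Lemma mxnorm_ge0 n (A : 'M[R[i]]_n) : 0 <= mxnorm A.
Proof.
apply: le_trans (vnorm_ge0 _) (mxnorm_ub (v := 0) A _).
by rewrite vnorm0 ler01.
Qed.

End operator_norm_of_matrices.

(** * Mixed averages of kernels *)

Section mixed_averages.
Context {R : realType} {d : nat} (p : R).
Hypothesis p1 : 1 < p.
Local Open Scope ereal_scope.

Lemma conjugate_gt0 : (0 < conjugate_exponent p)%R.
Proof.
by rewrite divr_gt0 ?subr_gt0// (lt_trans ltr01).
Qed.

Lemma conjugate_ratio : (p / conjugate_exponent p = p - 1)%R.
Proof.
have p0 : (p != 0)%R by rewrite gt_eqF// (lt_trans ltr01).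
have q0 : (p - 1 != 0)%R by rewrite subr_eq0 gt_eqF.
by rewrite /conjugate_exponent; field; rewrite p0 q0.
Qed.

Lemma average_ge0 (Q : set (Rd R d)) f : (forall x, 0 <= f x) ->
  0 <= average Q f.
Proof.
move=> f0; apply: mule_ge0; last exact: integral_ge0.
by rewrite lee_fin invr_ge0 fine_ge0.
Qed.

Lemma le_average_null (Q N : set (Rd R d)) f g (r : R) :
  (0 < r)%R -> (forall x, 0 <= f x) -> (forall x, 0 <= g x) ->
  measurable N -> lebesgue N = 0 -> (forall x, ~ N x -> r%:E * f x <= g x) ->
  r%:E * average Q f <= average Q g.
Proof.
move=> r0 f0 g0 mN N0 fg; rewrite /average muleCA; apply: lee_wpmul2l.
  by rewrite lee_fin invr_ge0 fine_ge0.
exact: (ge0_le_integral_null _ r0 f0 g0 mN N0 fg).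
Qed.

(** The p-th root of the mixed average is monotone and homogeneous of degree 1
    in the norm of the kernel: the inner average contributes r^p' and the
    outer power p/p' turns this into r^p. *)
Lemma mixed_average_le n k (K : Rd R d -> Rd R d -> 'M[R[i]]_n)
    (K' : Rd R d -> Rd R d -> 'M[R[i]]_k) (r : R) (N : set (Rd R d)) :
  (0 < r)%R -> measurable N -> lebesgue N = 0 ->
  (forall x y, ~ N x -> ~ N y -> r * mxnorm (K x y) <= mxnorm (K' x y))%R ->
  r%:E * mixed_average_sup p K `^ p^-1 <= mixed_average_sup p K' `^ p^-1.
Proof.
move=> r0 mN N0 hK; have p0 : (0 < p)%R by rewrite (lt_trans ltr01).
have q0 := conjugate_gt0.
pose I n (L : Rd R d -> Rd R d -> 'M[R[i]]_n) Q x :=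
  average Q (fun y => (mxnorm (L x y) `^ conjugate_exponent p)%:E).
have I0 n' (L : Rd R d -> Rd R d -> 'M[R[i]]_n') Q x : 0 <= I _ L Q x.
  by apply: average_ge0 => y; rewrite lee_fin powR_ge0.
have rp0 : (0 < r `^ p)%R by rewrite powR_gt0.
have key : (r `^ p)%:E * mixed_average_sup p K <= mixed_average_sup p K'.
  rewrite -lee_pdivlMl//; apply: ge_ereal_sup => _ [Q cQ <-].
  rewrite lee_pdivlMl//; apply: le_trans (ereal_sup_ubound _); last first.
    by exists Q; [exact: cQ|reflexivity].
  apply: (le_average_null _ rp0 _ _ mN N0) => [x|x|x Nx]; rewrite ?poweR_ge0//.
  rewrite conjugate_ratio.
  have -> : (r `^ p = (r `^ conjugate_exponent p) `^ (p - 1))%R.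
    by rewrite -powRrM -conjugate_ratio mulrC divfK// gt_eqF.
  rewrite -poweR_EFin -poweRM ?I0//; last by rewrite lee_fin powR_ge0.
  apply: gt0_ler_poweR.
  - by rewrite subr_ge0 ltW.
  - by rewrite in_itv/= leey andbT mule_ge0 ?I0// lee_fin powR_ge0.
  - by rewrite in_itv/= leey andbT I0.
  apply: (le_average_null _ _ _ _ mN N0) => [|y|y|y Ny].
  - by rewrite powR_gt0.
  - by rewrite lee_fin powR_ge0.
  - by rewrite lee_fin powR_ge0.
  rewrite -EFinM lee_fin -powRM ?(ltW r0) ?mxnorm_ge0//.
  apply: (ge0_ler_powR (ltW q0)); rewrite ?nnegrE ?mxnorm_ge0//.
    by rewrite mulr_ge0 ?mxnorm_ge0 ?(ltW r0).
  exact: hK.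
have M0 n' (L : Rd R d -> Rd R d -> 'M[R[i]]_n') : 0 <= mixed_average_sup p L.
  apply: le_trans (ereal_sup_ubound _); last first.
    by exists [set x | forall i, 0 <= (x : 'rV[R]_d) ord0 i <= 0 + 1]%R;
      [exists 0%R, 1%R; split => //; apply/seteqP; split => x /= h i;
       have := h i; rewrite mxE|reflexivity].
  by apply: average_ge0 => x; exact: poweR_ge0.
have -> : r%:E = (r `^ p)%:E `^ p^-1.
  by rewrite poweR_EFin -powRrM divff ?gt_eqF// powRr1// ltW.
rewrite -poweRM ?M0//; last by rewrite lee_fin ltW.
apply: gt0_ler_poweR key.
- by rewrite invr_ge0 ltW.
- by rewrite in_itv/= leey andbT mule_ge0 ?M0// lee_fin ltW.
- by rewrite in_itv/= leey andbT M0.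
Qed.

End mixed_averages.

(** * The block weight *)

Section block_weight.
Context {R : realType}.
Local Open Scope complex_scope.
Local Open Scope sesquilinear_scope.

Lemma posdef_gram n (F : 'M[R[i]]_n) :
  (forall u : 'cV[R[i]]_n, u != 0 -> F *m u != 0) -> posdefmx (F^t* *m F).
Proof.
move=> Finj; split.
  apply/is_hermitianmxP; rewrite expr0 scale1r.
  by rewrite trmx_mul map_mxM trmxCK.
move=> u u0; have -> : u^t* *m (F^t* *m F) *m u = (F *m u)^t* *m (F *m u).
  by rewrite trmx_mul map_mxM !mulmxA.
by rewrite quad1 ltcR exprn_gt0// vnorm_gt0// Finj.
Qed.

(** Polar decomposition: H = (F^* F)^(1/2) satisfies H^* H = H^2 = F^* F, so
    |H u| = |F u|. *)
Lemma vnorm_polar n (F : 'M[R[i]]_n) (p : R) (u : 'cV[R[i]]_n) : p != 0 ->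
  posdefmx (F^t* *m F) ->
  vnorm (mxpowR (mxpowR (F^t* *m F) (p / 2)) p^-1 *m u) = vnorm (F *m u).
Proof.
move=> p0 Gpos; set G := F^t* *m F in Gpos *.
have -> : mxpowR (mxpowR G (p / 2)) p^-1 = mxpowR G 2^-1.
  rewrite (mxpowRM _ _ Gpos); congr mxpowR.
  by rewrite mulrAC divff// mul1r.
have [/is_hermitianmxP + _] := mxpowR_posdef 2^-1 Gpos.
have HH : mxpowR G 2^-1 *m mxpowR G 2^-1 = G.
  have h2 : 2^-1 + 2^-1 = 1 :> R by lra.
  by rewrite (mxpowRD _ _ Gpos) h2 (mxpowR1 Gpos).
move: (mxpowR G 2^-1) HH => H HH; rewrite expr0 scale1r => Hh.
apply/eqP; rewrite -(@eqrXn2 _ 2)// ?vnorm_ge0//; apply/eqP/complexI.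
rewrite -!quad1 !trmx_mul !map_mxM -Hh -!mulmxA (mulmxA H) HH.
by rewrite /G -!mulmxA.
Qed.

Lemma mxpowRVl n (A : 'M[R[i]]_n) s : posdefmx A ->
  mxpowR A (- s) *m mxpowR A s = 1%:M.
Proof. by move=> Apos; rewrite (mxpowRD _ _ Apos) addNr mxpowR0. Qed.

Lemma mxpowRVr n (A : 'M[R[i]]_n) s : posdefmx A ->
  mxpowR A s *m mxpowR A (- s) = 1%:M.
Proof. by move=> Apos; rewrite (mxpowRD _ _ Apos) subrr mxpowR0. Qed.

Lemma mulmx_eq0_cancel n (X Y : 'M[R[i]]_n) (u : 'cV[R[i]]_n) :
  X *m Y = 1%:M -> Y *m u = 0 -> u = 0.
Proof.
by move=> XY /(congr1 (mulmx X)); rewrite mulmxA XY mul1mx mulmx0.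
Qed.

Lemma mulmx_cancel n (X Y Z : 'M[R[i]]_n) (u : 'cV[R[i]]_n) :
  Y *m Z = 1%:M -> (X *m Y) *m (Z *m u) = X *m u.
Proof. by move=> YZ; rewrite -mulmxA (mulmxA Y) YZ mul1mx. Qed.

Variables (m : nat) (p eps : R).
Implicit Types V U B : 'M[R[i]]_m.

Definition block_factor V U B : 'M[R[i]]_(m + m) :=
  block_mx (mxpowR V p^-1) (mxpowR V p^-1 *m B) 0 (eps%:C *: mxpowR U p^-1).

(** The exponent p/2 makes the (1/p)-th power of this weight equal to the
    absolute value of [block_factor]. *)
Definition block_weight V U B : 'M[R[i]]_(m + m) :=
  mxpowR ((block_factor V U B)^t* *m block_factor V U B) (p / 2).

(** The factor maps (a, b) to the pair of the V-part of a + B b and eps times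
    the U-part of b; this change of variable decouples the two spaces. *)
Lemma block_factorE V U B (a b : 'cV[R[i]]_m) :
  block_factor V U B *m col_mx a b =
  col_mx (mxpowR V p^-1 *m (a + B *m b)) (eps%:C *: (mxpowR U p^-1 *m b)).
Proof.
by rewrite mul_block_col mul0mx add0r mulmxDr mulmxA scalemxAl.
Qed.

Hypotheses (p0 : p != 0) (eps0 : 0 < eps).

Lemma block_gram_posdef V U B : posdefmx V -> posdefmx U ->
  posdefmx ((block_factor V U B)^t* *m block_factor V U B).
Proof.
move=> Vpos Upos; apply: posdef_gram => u; apply: contra_neq => Fu0.
have := Fu0; rewrite -(vsubmxK u) block_factorE -[0]col_mx0.
move=> /eq_col_mx[h1 h2].
have b0 : dsubmx u = 0.
  apply: (mulmx_eq0_cancel (mxpowRVl p^-1 Upos)).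
  move: h2 => /(congr1 (fun z => (eps^-1)%:C *: z)).
  by rewrite scalerA -rmorphM mulVf ?gt_eqF// scale1r scaler0.
have a0 := mulmx_eq0_cancel (mxpowRVl p^-1 Vpos) h1.
by move: a0; rewrite b0 mulmx0 addr0 => ->.
Qed.

Lemma block_weight_posdef V U B : posdefmx V -> posdefmx U ->
  posdefmx (block_weight V U B).
Proof. by move=> Vpos Upos; apply/mxpowR_posdef/block_gram_posdef. Qed.

Lemma vnorm_block_weight V U B (a b : 'cV[R[i]]_m) :
  posdefmx V -> posdefmx U ->
  vnorm (mxpowR (block_weight V U B) p^-1 *m col_mx a b) =
  vnorm (col_mx (mxpowR V p^-1 *m (a + B *m b))
                (eps%:C *: (mxpowR U p^-1 *m b))).
Proof.
move=> Vpos Upos; rewrite -block_factorE.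
exact: (vnorm_polar _ p0 (block_gram_posdef B Vpos Upos)).
Qed.

(** Given v, let u be the vector whose image under the factor at the primed
    point is (0, v).  Its image at the other point has first component
    eps^-1 times the kernel applied to v. *)
Lemma mxnorm_block_weight V U B V' U' B' :
  posdefmx V -> posdefmx U -> posdefmx V' -> posdefmx U' ->
  eps^-1 * mxnorm (mxpowR V p^-1 *m (B - B') *m mxpowR U' (- p^-1)) <=
  mxnorm (mxpowR (block_weight V U B) p^-1 *m
          mxpowR (block_weight V' U' B') (- p^-1)).
Proof.
move=> Vpos Upos V'pos U'pos.
rewrite ler_pdivrMl//; apply: mxnorm_le => v v1.
pose b := (eps^-1)%:C *: (mxpowR U' (- p^-1) *m v).
pose a := - (B' *m b).
have wE : vnorm (mxpowR (block_weight V' U' B') p^-1 *m col_mx a b) = vnorm v.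
  rewrite (vnorm_block_weight _ _ _ V'pos U'pos) /a addNr mulmx0.
  rewrite vnorm_col0 /b -scalemxAr scalerA -rmorphM divff ?gt_eqF// scale1r.
  by rewrite mulmxA (mxpowRVr _ U'pos) mul1mx.
have := mxnorm_ub (mxpowR (block_weight V U B) p^-1 *m
          mxpowR (block_weight V' U' B') (- p^-1))
          (v := mxpowR (block_weight V' U' B') p^-1 *m col_mx a b).
rewrite wE => /(_ v1).
rewrite (mulmx_cancel _ _ (mxpowRVl _ (block_weight_posdef B' V'pos U'pos))).
rewrite (vnorm_block_weight _ _ _ Vpos Upos) => h.
rewrite -ler_pdivrMl//; apply: le_trans h; apply: le_trans (vnorm_colu _ _).
have -> : a + B *m b = (eps^-1)%:C *: ((B - B') *m (mxpowR U' (- p^-1) *m v)).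
  by rewrite /a addrC -mulmxBl /b -scalemxAr.
by rewrite -scalemxAr vnormZ ?invr_ge0 ?(ltW eps0)// !mulmxA.
Qed.

End block_weight.

Section block_weight_functions.
Context {R : realType} {d m : nat} (p eps : R).
Hypotheses (p1 : 1 < p) (eps0 : 0 < eps).
Variables V U B : Rd R d -> 'M[R[i]]_m.
Hypotheses (Vw : matrix_weight V) (Uw : matrix_weight U).
Hypothesis mB : mxmeasurable B.
Local Open Scope complex_scope.

Let W x := block_weight p eps (V x) (U x) (B x).

Let p0 : 0 < p. Proof. exact: lt_trans ltr01 p1. Qed.

Let pinv0 : 0 < p^-1. Proof. by rewrite invr_gt0. Qed.

Lemma ae_posdef2 : {ae lebesgue, forall x, posdefmx (V x) /\ posdefmx (U x)}.
Proof. by case: Vw => _; case: Uw => _; apply: filterS2 => x. Qed.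

Lemma mxmeas_block_factor :
  mxmeasurable (fun x => block_factor p eps (V x) (U x) (B x)).
Proof.
have mV := mxmeas_powR pinv0 Vw.1 Vw.2.
have mU := mxmeas_powR pinv0 Uw.1 Uw.2.
have mVB := mxmeasM mV mB; have mUe := mxmeasZ eps%:C mU.
move=> i j; rewrite /block_factor.
case: (split_ordP i) => k ->; case: (split_ordP j) => l ->.
- by under eq_fun do rewrite block_mxEul; exact: mV k l.
- by under eq_fun do rewrite block_mxEur; exact: mVB k l.
- by under eq_fun do rewrite block_mxEdl mxE; exact: cmeas_cst.
- by under eq_fun do rewrite block_mxEdr; exact: mUe k l.
Qed.

Lemma matrix_weight_block : matrix_weight W.
Proof.
have Gpos : {ae lebesgue, forall x, posdefmx
    (((block_factor p eps (V x) (U x) (B x)) ^t (@Num.conj _))%sesqui *m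
     block_factor p eps (V x) (U x) (B x))}.
  apply: filterS ae_posdef2 => x [Vx Ux].
  exact: (block_gram_posdef p eps0 (B x) Vx Ux).
split.
  apply: mxmeas_powR Gpos; first by rewrite divr_gt0.
  exact: mxmeasM (mxmeas_adj mxmeas_block_factor) mxmeas_block_factor.
by apply: filterS Gpos => x; exact: mxpowR_posdef.
Qed.

Lemma BMO_norm_le_Ap :
  ((eps^-1)%:E * BMO_norm p V U B <= Ap_char p W `^ p^-1)%E.
Proof.
have [N [mN N0 hN]] := ae_posdef2.
apply: (mixed_average_le p1 _ mN N0); first by rewrite invr_gt0.
move=> x y Nx Ny.
have [Vx Ux] : posdefmx (V x) /\ posdefmx (U x).
  by apply: contrapT => h; apply: Nx; exact: hN.
have [Vy Uy] : posdefmx (V y) /\ posdefmx (U y).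
  by apply: contrapT => h; apply: Ny; exact: hN.
exact: (mxnorm_block_weight (lt0r_neq0 p0) eps0 _ _ Vx Ux Vy Uy).
Qed.

End block_weight_functions.

(** * Norms on weighted spaces *)

Section Lp_energy.
Context {R : realType} {d : nat} (p : R).
Hypothesis p0 : 0 < p.
Local Open Scope ereal_scope.

(** The p-th power of [Lp_norm]: pointwise bounds on p-th powers integrate term
    by term and replace Minkowski's inequality, at the cost of a constant. *)
Definition Lp_energy n (W : Rd R d -> 'M[R[i]]_n) (f : Rd R d -> 'cV[R[i]]_n) :
    \bar R :=
  \int[lebesgue]_x (vnorm (mxpowR (W x) p^-1 *m f x) `^ p)%:E.

Lemma Lp_energy_ge0 n (W : Rd R d -> 'M[R[i]]_n) f : 0 <= Lp_energy W f.
Proof. by apply: integral_ge0 => x _; rewrite lee_fin powR_ge0. Qed.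

Lemma Lp_norm_ge0 n (W : Rd R d -> 'M[R[i]]_n) f : 0 <= Lp_norm p W f.
Proof. exact: poweR_ge0. Qed.

Lemma poweR_le_inv (x y : \bar R) (r : R) : (0 < r)%R -> 0 <= x -> 0 <= y ->
  x `^ r <= y `^ r -> x <= y.
Proof.
move=> r0 x0 y0 h.
have E z : 0 <= z -> (z `^ r) `^ r^-1 = z.
  by move=> z0; rewrite -poweRrM divff ?gt_eqF// poweRe1.
rewrite -(E x x0) -(E y y0); apply: gt0_ler_poweR h.
- by rewrite invr_ge0 ltW.
- by rewrite in_itv/= leey andbT poweR_ge0.
- by rewrite in_itv/= leey andbT poweR_ge0.
Qed.

Lemma Lp_normE n (W : Rd R d -> 'M[R[i]]_n) f :
  Lp_norm p W f `^ p = Lp_energy W f.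
Proof.
by rewrite /Lp_norm -poweRrM mulVf ?gt_eqF// poweRe1// Lp_energy_ge0.
Qed.

Lemma le_Lp_norm n k (W : Rd R d -> 'M[R[i]]_n) (V : Rd R d -> 'M[R[i]]_k) f g
    (C : R) : (0 <= C)%R ->
  (Lp_norm p W f <= C%:E * Lp_norm p V g) <->
  (Lp_energy W f <= (C `^ p)%:E * Lp_energy V g).
Proof.
move=> C0; have CE : (C `^ p)%:E * Lp_energy V g = (C%:E * Lp_norm p V g) `^ p.
  by rewrite poweRM ?lee_fin ?Lp_norm_ge0// Lp_normE poweR_EFin.
have Cg0 : 0 <= C%:E * Lp_norm p V g by rewrite mule_ge0 ?lee_fin ?Lp_norm_ge0.
rewrite CE -Lp_normE; split; last exact: poweR_le_inv (Lp_norm_ge0 _ _) Cg0.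
move=> h; apply: gt0_ler_poweR h; first exact: ltW.
  by rewrite in_itv/= leey andbT Lp_norm_ge0.
by rewrite in_itv/= leey andbT.
Qed.

Lemma Lp_norm_lty n k (W : Rd R d -> 'M[R[i]]_n) (V : Rd R d -> 'M[R[i]]_k) f g
    (C : R) : Lp_norm p W f <= C%:E * Lp_norm p V g -> Lp_norm p V g < +oo ->
  Lp_norm p W f < +oo.
Proof.
move=> h g1; apply: (le_lt_trans h).
have : Lp_norm p V g \is a fin_num by rewrite ge0_fin_numE ?Lp_norm_ge0.
by move=> /fineK <-; rewrite -EFinM ltry.
Qed.

Lemma le_Lp_energy n k (W : Rd R d -> 'M[R[i]]_n) (V : Rd R d -> 'M[R[i]]_k)
    f g (r : R) : (0 < r)%R ->
  {ae lebesgue, forall x, r * vnorm (mxpowR (W x) p^-1 *m f x) <=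
                          vnorm (mxpowR (V x) p^-1 *m g x)}%R ->
  (r `^ p)%:E * Lp_energy W f <= Lp_energy V g.
Proof.
move=> r0 [N [mN N0 hN]].
apply: (ge0_le_integral_null _ _ _ _ mN N0) => [|x|x|x Nx].
- by rewrite powR_gt0.
- by rewrite lee_fin powR_ge0.
- by rewrite lee_fin powR_ge0.
rewrite -EFinM lee_fin -powRM ?(ltW r0) ?vnorm_ge0//.
apply: (ge0_ler_powR (ltW p0)); rewrite ?nnegrE ?vnorm_ge0//.
  by rewrite mulr_ge0 ?vnorm_ge0 ?(ltW r0).
by apply: contrapT => h; apply: Nx; apply: hN.
Qed.

Lemma measurable_energy n (W : Rd R d -> 'M[R[i]]_n) f : matrix_weight W ->
  mxmeasurable f ->
  measurable_fun setT (fun x => (vnorm (mxpowR (W x) p^-1 *m f x) `^ p)%:E).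
Proof.
move=> [mW Wpos] mf; apply/measurable_EFinP; apply: measurable_fun_powR.
have p'0 : (0 < p^-1)%R by rewrite invr_gt0.
apply: measurable_vnorm => i.
exact: mxmeasM (mxmeas_powR p'0 mW Wpos) mf i ord0.
Qed.

End Lp_energy.

Section operator_bounds.
Context {R : realType} {d : nat} (p : R).

Definition op_bounded n (U V : Rd R d -> 'M[R[i]]_n) S (C : R) :=
  0 <= C /\ forall f, in_Lp p U f ->
    [/\ vo_dom S f, in_Lp p V (S f) &
        (Lp_norm p V (S f) <= C%:E * Lp_norm p U f)%E].

Lemma operator_norm_le n (U V : Rd R d -> 'M[R[i]]_n) S C :
  op_bounded U V S C -> (operator_norm p U V S <= C%:E)%E.
Proof. by move=> h; apply: ereal_inf_lbound; exists C. Qed.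

(** The operator norm is an infimum; strictly above it there is a bound. *)
Lemma operator_norm_bound n (U V : Rd R d -> 'M[R[i]]_n) S (x y : R) :
  (operator_norm p U V S <= x%:E)%E -> x < y ->
  exists2 C, C <= y & op_bounded U V S C.
Proof.
move=> hx xy; have := le_lt_trans hx (_ : x%:E < y%:E)%E.
rewrite lte_fin => /(_ xy) /ereal_inf_lt[_ [C hC <-]].
by rewrite lte_fin => /ltW Cy; exists C.
Qed.

End operator_bounds.

Section combine.
Context {R : realType}.

Lemma vnormD_sq n (u v : 'cV[R[i]]_n) :
  vnorm (u + v) ^+ 2 <= 2 * vnorm u ^+ 2 + 2 * vnorm v ^+ 2.
Proof.
rewrite !vnorm_sq !mulr_sumr -big_split/=; apply: ler_sum => j _.
rewrite mxE; have := le_normcD (u j ord0) (v j ord0).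
move: (normc_ge0 (u j ord0 + v j ord0)) => h0 h.
apply: (@le_trans _ _ ((Normc.normc (u j ord0) + Normc.normc (v j ord0)) ^+ 2)).
  by rewrite ler_sqr// nnegrE// addr_ge0// normc_ge0.
have := sqr_ge0 (Normc.normc (u j ord0) - Normc.normc (v j ord0)).
by rewrite sqrrB sqrrD; lra.
Qed.

Lemma vnorm_col_mxD m n (a b : 'cV[R[i]]_m) (c : 'cV[R[i]]_n) :
  vnorm (col_mx (a + b) c) <= 2 * (vnorm a + vnorm b + vnorm c).
Proof.
have [a0 b0 c0] : [/\ 0 <= vnorm a, 0 <= vnorm b & 0 <= vnorm c].
  by split; exact: vnorm_ge0.
rewrite -ler_sqr ?nnegrE ?vnorm_ge0//; last by lra.
rewrite vnorm_col_mx; have := vnormD_sq a b.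
by move: (vnorm a) (vnorm b) (vnorm c) (vnorm (a + b)) a0 b0 c0 => *; nra.
Qed.

(** a + b + c is at most three times the largest of its terms. *)
Lemma powR_add3 (p a b c : R) : 1 < p -> 0 <= a -> 0 <= b -> 0 <= c ->
  (2 * (a + b + c)) `^ p <= 6 `^ p * (a `^ p + b `^ p + c `^ p).
Proof.
move=> p1 a0 b0 c0; have p0 : 0 < p by exact: lt_trans ltr01 p1.
have step z : 0 <= z -> 2 * (a + b + c) <= 6 * z ->
    (2 * (a + b + c)) `^ p <= 6 `^ p * z `^ p.
  move=> z0 hz; rewrite -powRM//; apply: (ge0_ler_powR (ltW p0)) => //.
    by rewrite nnegrE; lra.
  by rewrite nnegrE; lra.
have {}step z : 0 <= z -> 2 * (a + b + c) <= 6 * z ->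
    z `^ p <= a `^ p + b `^ p + c `^ p ->
    (2 * (a + b + c)) `^ p <= 6 `^ p * (a `^ p + b `^ p + c `^ p).
  move=> z0 hz h; apply: le_trans (step z z0 hz) _.
  by rewrite ler_wpM2l// powR_ge0.
move: (powR_ge0 a p) (powR_ge0 b p) (powR_ge0 c p) => ap bp cp.
have [ba|ab] := leP b a; have [ca|ac] := leP c a; have [cb|bc] := leP c b;
  first [by apply: (step a) => //; lra | by apply: (step b) => //; lra |
         by apply: (step c) => //; lra].
Qed.

End combine.

(** * Operators on the space of the block weight *)

Lemma integral_le_comb3 dd (X : measurableType dd) (R : realType)
    (mu : {measure set X -> \bar R}) (F a b c : X -> R) (K e : R) :
  (forall x, 0 <= F x) -> (forall x, 0 <= a x) -> (forall x, 0 <= b x) ->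
  (forall x, 0 <= c x) -> 0 <= K -> 0 <= e ->
  measurable_fun setT (fun x => (a x)%:E) ->
  measurable_fun setT (fun x => (b x)%:E) ->
  measurable_fun setT (fun x => (c x)%:E) ->
  {ae mu, forall x, F x <= K * (a x + b x + e * c x)} ->
  (\int[mu]_x (F x)%:E <= K%:E * (\int[mu]_x (a x)%:E +
    \int[mu]_x (b x)%:E + e%:E * \int[mu]_x (c x)%:E))%E.
Proof.
move=> F0 a0 b0 c0 K0 e0 ma mb mc [N [mN N0 hN]].
have a0' x : (0 <= (a x)%:E)%E by rewrite lee_fin.
have b0' x : (0 <= (b x)%:E)%E by rewrite lee_fin.
have c0' x : (0 <= (c x)%:E)%E by rewrite lee_fin.
have ec0 x : (0 <= e%:E * (c x)%:E)%E by rewrite -EFinM lee_fin mulr_ge0.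
have mec : measurable_fun setT (fun x => e%:E * (c x)%:E)%E.
  exact: measurable_funeM.
have ab0 x : (0 <= (a x)%:E + (b x)%:E)%E by rewrite -EFinD lee_fin addr_ge0.
have mab := emeasurable_funD ma mb.
rewrite -(ge0_integralZl_EFin mu measurableT (fun x _ => c0' x) mc e0).
rewrite -(ge0_integralD mu measurableT (fun x _ => a0' x) ma
  (fun x _ => b0' x) mb).
rewrite -(ge0_integralD mu measurableT (fun x _ => ab0 x) mab
  (fun x _ => ec0 x) mec).
have abc0 x : (0 <= (a x)%:E + (b x)%:E + e%:E * (c x)%:E)%E.
  by rewrite adde_ge0.
have mabc := emeasurable_funD mab mec.
rewrite -(ge0_integralZl_EFin mu measurableT (fun x _ => abc0 x) mabc K0).
rewrite -[leLHS]mul1e.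
apply: (ge0_le_integral_null _ ltr01 _ _ mN N0) => [x|x|x Nx].
- by rewrite lee_fin.
- by rewrite mule_ge0.
rewrite mul1e lee_fin.
by apply: contrapT => h; apply: Nx; apply: hN.
Qed.

Section block_operator.
Context {R : realType} {d m : nat} (p eps : R).
Hypotheses (p1 : 1 < p) (eps0 : 0 < eps).
Variables V U B : Rd R d -> 'M[R[i]]_m.
Hypotheses (Vw : matrix_weight V) (Uw : matrix_weight U).
Hypothesis mB : mxmeasurable B.
Variable T : linear_operator R d.
Local Open Scope complex_scope.

Let W x := block_weight p eps (V x) (U x) (B x).
Let p0 : 0 < p. Proof. exact: lt_trans ltr01 p1. Qed.

Lemma vec_measurable n (f : Rd R d -> 'cV[R[i]]_n) :
  (forall i, cmeasurable (fun x => f x i ord0)) -> mxmeasurable f.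
Proof. by move=> mf i j; rewrite (ord1 j). Qed.

Lemma vnorm_block_ae (f : Rd R d -> 'cV[R[i]]_(m + m)) :
  {ae lebesgue, forall x, vnorm (mxpowR (W x) p^-1 *m f x) =
    vnorm (col_mx (mxpowR (V x) p^-1 *m (usubmx (f x) + B x *m dsubmx (f x)))
                  (eps%:C *: (mxpowR (U x) p^-1 *m dsubmx (f x))))}.
Proof.
apply: filterS (ae_posdef2 Vw Uw) => x [Vx Ux].
rewrite -{1}(vsubmxK (f x)).
exact: (vnorm_block_weight (lt0r_neq0 p0) eps0 _ _ _ Vx Ux).
Qed.

Lemma tensorI_col (f : Rd R d -> 'cV[R[i]]_(m + m)) x :
  tensorI (m + m) T f x = col_mx (tensorI m T (fun y => usubmx (f y)) x)
                                 (tensorI m T (fun y => dsubmx (f y)) x).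
Proof.
apply/colP => i; case: (split_ordP i) => k ->; rewrite ?col_mxEu ?col_mxEd.
  by rewrite /= !mxE; congr (T _ x); apply/funext => y; rewrite mxE.
by rewrite /= !mxE; congr (T _ x); apply/funext => y; rewrite mxE.
Qed.

(** An operator defined at two functions is defined at their difference and is
    additive there up to a null set, which may depend on the component. *)
Lemma tensorI_sub (f g : Rd R d -> 'cV[R[i]]_m) :
  vo_dom (tensorI m T) f -> vo_dom (tensorI m T) g ->
  vo_dom (tensorI m T) (fun x => g x - f x) /\
  {ae lebesgue, forall x, tensorI m T (fun x => g x - f x) x =
                          tensorI m T g x - tensorI m T f x}.
Proof.
move=> /= df dg.
have E i : (fun x => (g x - f x) i ord0) =
           (fun x => (-1) * f x i ord0 + g x i ord0).
  by apply/funext => x; rewrite !mxE mulN1r addrC.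
split=> [i|]; first by rewrite E; exact: lo_domP.
have h i : {ae lebesgue, forall x,
    T (fun y => (g y - f y) i ord0) x =
    (-1) * T (fun y => f y i ord0) x + T (fun y => g y i ord0) x}.
  by rewrite E; exact: lo_linear.
apply: filterS (filter_forall _ h) => x hx.
by apply/colP => i; rewrite !mxE hx mulN1r addrC.
Qed.

(** With g = f1 + B f2, the first component of F (T f) is V^(1/p) applied to
    T f1 + B T f2 = T g + [B, T] f2, and the second is eps U^(1/p) T f2, while
    |g|_V and eps |f2|_U are at most |f|_W.  The factor 18 is 2 * 3 * 3: the 2
    is that of [vnorm_col_mxD], the first 3 that of [powR_add3], and the second
    3 comes from adding three p-th powers, each at most that of the sum. *)
Lemma op_bounded_block Ca Cb Ck :
  op_bounded p V V (tensorI m T) Ca -> op_bounded p U U (tensorI m T) Cb ->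
  op_bounded p U V (commutator B (tensorI m T)) Ck ->
  op_bounded p W W (tensorI (m + m) T) (18 * (Ca + Ck / eps + Cb)).
Proof.
move=> [Ca0 hV] [Cb0 hU] [Ck0 hB].
have Ce0 : 0 <= Ck / eps by rewrite divr_ge0// ltW.
have ei0 : 0 <= eps^-1 by rewrite invr_ge0 ltW.
have S0 : 0 <= Ca + Ck / eps + Cb by rewrite !addr_ge0.
have C0 : 0 <= 18 * (Ca + Ck / eps + Cb) by rewrite mulr_ge0.
have Ww : matrix_weight W := matrix_weight_block p1 eps0 Vw Uw mB.
split; [exact: C0|move=> f [mf fW]].
pose g1 x := usubmx (f x) + B x *m dsubmx (f x).
pose g2 x := dsubmx (f x).
have mg2 : mxmeasurable g2.
  by move=> i j; rewrite (ord1 j) /g2; under eq_fun do rewrite mxE; exact: mf.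
have mu : mxmeasurable (fun x => usubmx (f x)).
  by move=> i j; rewrite (ord1 j); under eq_fun do rewrite mxE; exact: mf.
have mg1 : mxmeasurable g1 := mxmeasD mu (mxmeasM mB mg2).
have e1 : (Lp_energy p V g1 <= Lp_energy p W f)%E.
  have h : ((1 `^ p)%:E * Lp_energy p V g1 <= Lp_energy p W f)%E.
    apply: (le_Lp_energy p0 ltr01).
    apply: filterS (vnorm_block_ae f) => x ->; rewrite mul1r.
    exact: vnorm_colu.
  by move: h; rewrite powR1 mul1e.
have e2 : ((eps `^ p)%:E * Lp_energy p U g2 <= Lp_energy p W f)%E.
  apply: (le_Lp_energy p0 eps0).
  apply: filterS (vnorm_block_ae f) => x ->; rewrite -vnormZ ?(ltW eps0)//.
  exact: vnorm_cold.
have n1 : (Lp_norm p V g1 <= 1%:E * Lp_norm p W f)%E.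
  by apply/(le_Lp_norm p0); rewrite ?powR1 ?mul1e.
have n2 : (Lp_norm p U g2 <= (eps^-1)%:E * Lp_norm p W f)%E.
  apply/(le_Lp_norm p0); first by rewrite invr_ge0 ltW.
  by rewrite -powR_inv1 ?(ltW eps0)// powRAC powR_inv1 ?powR_ge0//
    lee_pdivlMl// powR_gt0.
have in1 : in_Lp p V g1.
  by split; [move=> i; exact: mg1|exact: Lp_norm_lty n1 fW].
have in2 : in_Lp p U g2.
  by split; [move=> i; exact: mg2|exact: Lp_norm_lty n2 fW].
have [d1 [mh1 h1fin] b1] := hV _ in1.
have [d2 [mh2 h2fin] b2] := hU _ in2.
have [[[_ _] [_ dB2]] [mk kfin] bk] := hB _ in2.
pose h1 := tensorI m T g1; pose h2 := tensorI m T g2.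
pose k := commutator B (tensorI m T) g2.
have dB2' : vo_dom (tensorI m T) (fun x => B x *m g2 x) := dB2.
(* f1 = g1 - B g2 lies in the domain because both terms do: the first by
   boundedness on L^p(V), the second because the commutator is defined at g2. *)
have [du Tu] := tensorI_sub dB2' d1.
have uE : (fun x => g1 x - B x *m g2 x) = (fun x => usubmx (f x)).
  by apply/funext => x; rewrite /g1 addrK.
rewrite uE in du Tu.
have Tu' : {ae lebesgue, forall x,
    tensorI m T (fun y => usubmx (f y)) x = h1 x + k x - B x *m h2 x}.
  apply: filterS Tu => x ->; rewrite /k /h1 /h2 /=.
  by rewrite -addrA; congr (_ + _); rewrite addrAC subrr add0r.
have mh1' : mxmeasurable h1 by exact: vec_measurable.
have mh2' : mxmeasurable h2 by exact: vec_measurable.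
have mk' : mxmeasurable k by exact: vec_measurable.
have mTu : mxmeasurable (tensorI m T (fun y => usubmx (f y))).
  apply: (mxmeas_ae (A := fun x => h1 x + k x + (-1) *: (B x *m h2 x))).
    exact: mxmeasD (mxmeasD mh1' mk') (mxmeasZ (-1) (mxmeasM mB mh2')).
  by apply: filterS Tu' => x ->; rewrite scaleN1r.
have bound : (Lp_energy p W (tensorI (m + m) T f) <=
    (6 `^ p)%:E * (Lp_energy p V h1 + Lp_energy p V k +
                   (eps `^ p)%:E * Lp_energy p U h2))%E.
  have me1 := measurable_energy p0 Vw mh1'.
  have mek := measurable_energy p0 Vw mk'.
  have me2 := measurable_energy p0 Uw mh2'.
  apply: (integral_le_comb3 _ _ _ _ _ _ me1 mek me2);
    rewrite ?powR_ge0//; try by move=> x; exact: powR_ge0.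
  apply: filterS2 (vnorm_block_ae (tensorI (m + m) T f)) Tu' => x -> hx.
  (* T f1 + B T f2 = (h1 + k - B h2) + B h2 = h1 + k *)
  rewrite tensorI_col col_mxKu col_mxKd hx -/h2 subrK mulmxDr.
  rewrite -powRM ?(ltW eps0) ?vnorm_ge0// -vnormZ ?(ltW eps0)//.
  apply: le_trans (powR_add3 p1 _ _ _); rewrite ?vnorm_ge0//.
  apply: (ge0_ler_powR (ltW p0)); rewrite ?nnegrE ?vnorm_ge0//.
    by rewrite mulr_ge0// !addr_ge0 ?vnorm_ge0.
  exact: vnorm_col_mxD.
have E1 : (Lp_energy p V h1 <= (Ca `^ p)%:E * Lp_energy p W f)%E.
  apply: le_trans ((le_Lp_norm p0 _ _ _ _ Ca0).1 b1) _.
  by apply: lee_wpmul2l => //; rewrite lee_fin powR_ge0.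
have E2 : ((eps `^ p)%:E * Lp_energy p U h2 <=
    (Cb `^ p)%:E * Lp_energy p W f)%E.
  apply: (@le_trans _ _ ((eps `^ p)%:E * ((Cb `^ p)%:E * Lp_energy p U g2))%E).
    apply: lee_wpmul2l; first by rewrite lee_fin powR_ge0.
    exact: ((le_Lp_norm p0 _ _ _ _ Cb0).1 b2).
  rewrite muleCA; apply: lee_wpmul2l => //.
  by rewrite lee_fin powR_ge0.
have Ek : (Lp_energy p V k <= ((Ck / eps) `^ p)%:E * Lp_energy p W f)%E.
  apply: le_trans ((le_Lp_norm p0 _ _ _ _ Ck0).1 bk) _.
  rewrite (powRM p Ck0 ei0) EFinM -muleA.
  apply: lee_wpmul2l; first by rewrite lee_fin powR_ge0.
  exact: ((le_Lp_norm p0 _ _ _ _ ei0).1 n2).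
have key : (Lp_norm p W (tensorI (m + m) T f) <=
    (18 * (Ca + Ck / eps + Cb))%:E * Lp_norm p W f)%E.
  apply/(le_Lp_norm p0 _ _ _ _ C0); apply: le_trans bound _.
  set Y := Lp_energy p W f in E1 E2 Ek *.
  have Y0 : (0 <= Y)%E by exact: Lp_energy_ge0.
  apply: (@le_trans _ _ ((6 `^ p)%:E * ((Ca `^ p)%:E * Y +
    ((Ck / eps) `^ p)%:E * Y + (Cb `^ p)%:E * Y))%E).
    apply: lee_wpmul2l; first by rewrite lee_fin powR_ge0.
    by apply: leeD => //; apply: leeD.
  rewrite -!ge0_muleDl ?lee_fin ?addr_ge0 ?powR_ge0//.
  rewrite -!EFinD muleA -EFinM; apply: lee_wpmul2r => //; rewrite lee_fin.
  have -> : 18 * (Ca + Ck / eps + Cb) = 6 * (3 * (Ca + Ck / eps + Cb)) by ring.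
  have S3 : 0 <= 3 * (Ca + Ck / eps + Cb) by rewrite mulr_ge0.
  rewrite (powRM p (ler0n R 6) S3); apply: ler_wpM2l; first exact: powR_ge0.
  rewrite (powRM p (ler0n R 3) S0).
  have mono z : 0 <= z -> z <= Ca + Ck / eps + Cb ->
      z `^ p <= (Ca + Ck / eps + Cb) `^ p.
    by move=> z0 hz; apply: (ge0_ler_powR (ltW p0)).
  have h3 : 3 <= 3 `^ p :> R by apply: le1r_powR; [lra|exact: ltW].
  apply: (@le_trans _ _ (3 * (Ca + Ck / eps + Cb) `^ p)); last first.
    by rewrite ler_wpM2r ?powR_ge0.
  have ha : Ca `^ p <= (Ca + Ck / eps + Cb) `^ p by apply: mono => //; lra.
  have hk : (Ck / eps) `^ p <= (Ca + Ck / eps + Cb) `^ p.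
    by apply: mono => //; lra.
  have hb : Cb `^ p <= (Ca + Ck / eps + Cb) `^ p by apply: mono => //; lra.
  lra.
split; last exact: key.
- move=> i /=; case: (split_ordP i) => l ->.
    have := du l; congr (lo_dom T _); apply/funext => x.
    by rewrite mxE.
  have := d2 l; congr (lo_dom T _); apply/funext => x.
  by rewrite mxE.
- split; last exact: Lp_norm_lty key fW.
  move=> i; under eq_fun do rewrite tensorI_col.
  case: (split_ordP i) => l ->.
    by under eq_fun do rewrite col_mxEu; exact: mTu.
  by under eq_fun do rewrite col_mxEd; exact: mh2'.
Qed.

End block_operator.

Theorem lemma1p4 (R : realType) (d : nat) (p : R) (N : nat)
    (T : 'I_N -> linear_operator R d) :
  (0 < d)%N -> 1 < p -> lower_bound_collection p T ->
  forall m : nat, (0 < m)%N ->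
  exists2 C : R, 0 < C &
    forall U V B : Rd R d -> 'M[R[i]]_m,
      Ap_weight p U -> Ap_weight p V -> locally_integrable_symbol B ->
      (BMO_norm p V U B <=
       C%:E * \big[maxe/0]_(s < N)
                operator_norm p U V (commutator B (tensorI m (T s))))%E.
Proof.
move=> _ p1 lbc m m0.
have [[C C0 hC] _] := lbc (m + m)%N (ltn_addl m m0).
have [_ bdd] := lbc m m0.
exists (18 * C); first by rewrite mulr_gt0.
move=> U V B Up Vp Bloc.
have mB : mxmeasurable B by move=> i j; have [] := Bloc i j.
set X := \big[maxe/0%E]_(s < N) _.
have X0 : (0 <= X)%E by exact: bigmax_ge_id.
have [Xoo|Xfin] := eqVneq X +oo%E.
  by rewrite Xoo gt0_muley ?leey// lte_fin mulr_gt0.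
have {}Xfin : X = (fine X)%:E.
  by rewrite fineK// ge0_fin_numE// lt_neqAle Xfin leey.
set M := (\big[maxe/0]_(s < N) maxe (operator_norm p V V (tensorI m (T s)))
                                    (operator_norm p U U (tensorI m (T s))))%E.
have M0 : (0 <= M)%E by exact: bigmax_ge_id.
have Mfin : M = (fine M)%:E.
  rewrite fineK// ge0_fin_numE//; apply: bigmax_lt => // s _.
  by rewrite gt_max; apply/andP; split; exact: bdd.
have {M0} fM0 : 0 <= fine M by exact: fine_ge0.
have fX0 : 0 <= fine X by exact: fine_ge0.
have hop eps : 0 < eps -> forall s,
  (operator_norm p (fun x => block_weight p eps (V x) (U x) (B x))
     (fun x => block_weight p eps (V x) (U x) (B x)) (tensorI (m + m) (T s)) <=
   (18 * (2 * fine M + 3 + fine X / eps))%:E)%E.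
  move=> eps0 s.
  have hMs : (maxe (operator_norm p V V (tensorI m (T s)))
     (operator_norm p U U (tensorI m (T s))) <= (fine M)%:E)%E.
    by rewrite -Mfin; exact: (le_bigmax _ _ s).
  move: hMs; rewrite ge_max => /andP[hVs hUs].
  have hXs : (operator_norm p U V (commutator B (tensorI m (T s))) <=
      (fine X)%:E)%E by rewrite -Xfin; exact: (le_bigmax _ _ s).
  have M1 : fine M < fine M + 1 by rewrite ltrDl.
  have Xe : fine X < fine X + eps by rewrite ltrDl.
  have [Ca Ca1 bCa] := operator_norm_bound hVs M1.
  have [Cb Cb1 bCb] := operator_norm_bound hUs M1.
  have [Ck Ck1 bCk] := operator_norm_bound hXs Xe.
  have bW := op_bounded_block p1 eps0 Vp.1 Up.1 mB bCa bCb bCk.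
  apply: le_trans (operator_norm_le bW) _; rewrite lee_fin ler_pM2l//.
  have : Ck / eps <= fine X / eps + 1.
    by rewrite -[X in _ + X](divff (lt0r_neq0 eps0)) -mulrDl ler_pM2r ?invr_gt0.
  by move=> h; lra.
have hBMO eps : 0 < eps -> (BMO_norm p V U B <=
    (18 * C * fine X)%:E + (eps * (18 * C * (2 * fine M + 3)))%:E)%E.
  move=> eps0.
  have := BMO_norm_le_Ap p1 eps0 B Vp.1 Up.1.
  have Ww := matrix_weight_block p1 eps0 Vp.1 Up.1 mB.
  move=> /le_trans/(_ (hC _ Ww)) => h.
  have {}h : ((eps^-1)%:E * BMO_norm p V U B <=
      C%:E * (18 * (2 * fine M + 3 + fine X / eps))%:E)%E.
    apply: le_trans h _; apply: lee_wpmul2l; first by rewrite lee_fin ltW.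
    apply: bigmax_le => [|s _]; last exact: hop.
    by rewrite lee_fin mulr_ge0// !addr_ge0 ?mulr_ge0 ?invr_ge0 ?(ltW eps0).
  have ei0 : 0 < eps^-1 by rewrite invr_gt0.
  move: h; rewrite -(lee_pdivlMl _ _ ei0) invrK => /le_trans; apply.
  rewrite -!EFinM -EFinD lee_fin le_eqVlt; apply/orP; left; apply/eqP.
  by field; exact: lt0r_neq0.
have L0 : 0 < 18 * C * (2 * fine M + 3).
  by rewrite !mulr_gt0// ltr_pwDr// mulr_ge0.
rewrite Xfin -EFinM; apply/lee_addgt0Pr => e e0.
(* eps is chosen so that the term without the commutator equals e. *)
apply: le_trans (hBMO (e / (18 * C * (2 * fine M + 3))) _) _.
  by rewrite divr_gt0.
by rewrite divfK// lt0r_neq0.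
Qed.
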